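(* Let $d\ge1$ and $l\ge0$ be integers and let $p:\mathbb{N}\to[0,1]$ be such that $$\lim_{n\to\infty}c_l(n)=-\infty,\qquad \lim_{n\to\infty}c_{l+1}(n)=+\infty.$$ Fix $k\in\mathbb{N}$. Then asymptotically almost surely the complement of the largest connected component of $G^{d+1}(n,p)$ consists of a disjoint union of butterflies of order at most $l$ and nothing else. Moreover, asymptotically almost surely, for each isomorphism type of butterfly of order $\le l$ there are at least $k$ connected components that are butterflies of that type.
   Context: $G^{d+1}(n,p)$ is the random $(d+1)$-uniform hypergraph on $n$ labelled vertices in which each of the $\binom{n}{d+1}$ potential edges ($(d+1)$-element vertex sets) is present with probability $p$, independently of the others. ''Asymptotically almost surely'' means with probability tending to $1$ as $n\to\infty$. A butterfly is a connected Berge-acyclic $(d+1)$-uniform hypergraph (its bipartite vertex-edge incidence graph has no cycles); the order of a finite butterfly is its number of edges (a single vertex has order $0$). For an integer $j\ge0$, $$c_j(n)=\frac{n^d(1+jd)}{d!}\,p(n)-\log n-j\log\log n.$$ *)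

(* Defs.v *)
From mathcomp Require Import all_boot all_order all_algebra.
From mathcomp Require Import all_classical all_reals all_analysis.
Set Implicit Arguments.
Unset Strict Implicit.
Unset Printing Implicit Defensive.
Import Order.TTheory GRing.Theory Num.Theory.
Import numFieldNormedType.Exports.
Local Open Scope ring_scope.

(* A finite hypergraph has all of a finType [V] as vertex set and is given by
   its set of edges, so isolated vertices are part of it. *)
Definition hypergraph (V : finType) : Type := {set {set V}}.

Section Hypergraphs.
Variable V : finType.
Implicit Types (H : hypergraph V) (C : {set V}).

Definition uniform (r : nat) H : Prop := forall e, e \in H -> #|e| = r.

Definition hadjacent H : rel V :=
  fun u v => [exists e in H, (u \in e) && (v \in e)].

(* The hypergraph without vertices is not connected. *)
Definition hconnected H : Prop :=
  (0 < #|V|)%N /\ forall u v, connect (hadjacent H) u v.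

Definition incidence H : rel (V + {set V}) := fun x y =>
  match x, y with
  | inl v, inr e | inr e, inl v => (e \in H) && (v \in e)
  | _, _ => false
  end.

(* [ucycle] admits the empty sequence, and the sequence [:: x; y] for every
   edge xy of the incidence graph; graph cycles are those of length > 2. *)
Definition berge_acyclic H : Prop :=
  forall s, ucycle (incidence H) s -> (size s <= 2)%N.

Definition butterfly (d : nat) H : Prop :=
  [/\ hconnected H, berge_acyclic H & uniform d.+1 H].

Definition components H : {set {set V}} :=
  equivalence_partition (connect (hadjacent H)) [set: V].

Definition sub_hypergraph H C : hypergraph {v : V | v \in C} :=
  [set e : {set {v : V | v \in C}} | val @: e \in H].

Definition largest_component H C : Prop :=
  C \in components H /\
  forall D, D \in components H -> D != C -> (#|D| < #|C|)%N.

End Hypergraphs.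

Definition isomorphic (V W : finType) (H : hypergraph V) (K : hypergraph W) :
    Prop :=
  exists2 f : V -> W, bijective f & forall e : {set V}, (f @: e \in K) = (e \in H).

Definition potential_edges (d n : nat) : {set {set 'I_n}} :=
  [set e : {set 'I_n} | #|e| == d.+1].

(* The probability that G^{d+1}(n, q) satisfies [A]. *)
Definition Pr (R : realType) (d n : nat) (q : R)
    (A : hypergraph 'I_n -> Prop) : R :=
  \sum_(H in powerset (potential_edges d n) | `[< A H >])
    \prod_(e in potential_edges d n) (if e \in H then q else 1 - q).

Definition aas (R : realType) (d : nat) (p : nat -> R)
    (A : forall n, hypergraph 'I_n -> Prop) : Prop :=
  (Pr d (p n) (A n) @[n --> \oo] --> (1 : R))%classic.

Definition c_ (R : realType) (d j : nat) (p : nat -> R) (n : nat) : R :=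
  (n%:R ^+ d * (1 + j * d)%N%:R) / (d`!)%:R * p n - ln n%:R - j%:R * ln (ln n%:R).

Definition small_outside_largest (d l n : nat) (H : hypergraph 'I_n) : Prop :=
  exists2 L, largest_component H L &
    forall C, C \in components H -> C != L ->
      butterfly d (sub_hypergraph H C) /\ (#|sub_hypergraph H C| <= l)%N.

(* Every finite hypergraph is isomorphic to one on some 'I_m. *)
Definition all_small_butterflies (d l k n : nat) (H : hypergraph 'I_n) : Prop :=
  forall (m : nat) (B : hypergraph 'I_m), butterfly d B -> (#|B| <= l)%N ->
    (k <= #|[set C in components H | `[< isomorphic B (sub_hypergraph H C) >]]|)%N.

(* Main.v *)
Require Import Defs.
From mathcomp Require Import all_boot all_order all_algebra.
From mathcomp Require Import all_classical all_reals all_analysis.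
From mathcomp Require Import zify lra ring.
Set Implicit Arguments.
Unset Strict Implicit.
Unset Printing Implicit Defensive.
Import Order.TTheory GRing.Theory Num.Theory.
Import numFieldNormedType.Exports.
Local Open Scope ring_scope.

(** Put lam = p n^d / d!, the expected degree of a vertex to leading order; the
    hypotheses force lam to be of order ln n.  A butterfly with j edges has
    1 + j d vertices, so the expected number of components that are butterflies
    with j edges is, up to a constant factor,
      n^(1+jd) p^j exp (- (1+jd) lam), that is, exp (- c_j).
    This tends to infinity for j <= l and to 0 for j = l+1, and the theorem says
    that the random hypergraph follows these expectations.

    Outside the largest component: a union S of components, called edge-closed
    below, misses the at least |S| C(n-|S|, d) potential edges that have exactly
    one vertex in S.  With high probability there is
    - no edge-closed S with n/4 <= |S| <= n/2, because the probability of each is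
      superexponentially small (negligible_balanced_cut); hence some component
      has more than n/2 vertices (giant_component);
    - no component S with K <= |S| <= n/2, for a large constant K
      (negligible_medium_component).  There are too many sets S for a union
      bound that forgets that S is connected.  Instead of counting spanning
      structures, compare p with p/2: a connected S has at most |S| - 1 edges
      that already connect it, so thinning the edges by 1/2 preserves the
      component S with probability at least 2^(1-|S|), while having no edge
      leave S is exponentially more likely at p/2 than at p
      (thinning, prob_component_halve).  The expected number of components at
      p/2 is at most n, so nothing has to be enumerated;
    - no edge-closed S with s < K vertices and t inner edges when s <= d t, or
      1 + (l+1) d < s <= 1 + d t, or (s, t) = (1 + (l+1) d, l+1): there are
      O(n^s p^t exp (- s lam)) of them in expectation (negligible_excluded).
    A component with s vertices and t edges satisfies s <= 1 + d t, with equality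
    exactly for butterflies (component_card, card_acyclic), so only butterflies
    with at most l edges remain besides the component of more than n/2 vertices.

    Many copies: for a fixed butterfly with m vertices choose one copy on every
    m-subset of the vertices and count the subsets whose chosen copy is a
    component.  Two such events exclude each other on intersecting subsets and
    are almost independent on disjoint ones, so Chebyshev's inequality
    (second_moment, prob_few_copies) applies, as the mean is of order
    exp (- c_j).  Only finitely many butterflies have at most l edges. *)

(** * Growing edge sets inside a hypergraph *)
Section Combinatorics.
Import mathcomp.boot.fintype mathcomp.boot.finset.
Local Open Scope nat_scope.
Variable V : finType.
Implicit Types (H F J : hypergraph V) (U C e : {set V}).

(** The unions of connected components, described without paths: this form is a
    condition on which edges are absent. *)
Definition edge_closed H U :=
  [forall e in H, [exists x in e, x \in U] ==> (e \subset U)].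

Lemma edge_closedP H U :
  reflect (forall e x, e \in H -> x \in e -> x \in U -> e \subset U)
          (edge_closed H U).
Proof.
apply: (iffP forallP) => [h e x eH xe xU|h e].
  move: (h e); rewrite eH /= => /implyP; apply.
  by apply/existsP; exists x; rewrite xe.
apply/implyP => eH; apply/implyP => /existsP[x /andP[xe xU]].
exact: h eH xe xU.
Qed.

Lemma edge_closedU H U W : edge_closed H U -> edge_closed H W -> edge_closed H (U :|: W).
Proof.
move=> /edge_closedP hU /edge_closedP hW; apply/edge_closedP => e x eH xe.
rewrite inE => /orP[xU|xW].
  by apply: subset_trans (hU _ _ eH xe xU) _; apply: subsetUl.
by apply: subset_trans (hW _ _ eH xe xW) _; apply: subsetUr.
Qed.

(** Common shape of the counting arguments below: add to F, one at a time, edges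
    that meet U without lying in it, and enlarge U by their vertices.  As U
    grows, this stops, at a union of components, and every property kept by a
    single step holds there. *)
Lemma saturate H (P : {set {set V}} -> {set V} -> Prop) F0 U0 :
  F0 \subset H -> {in F0, forall e, e \subset U0} -> P F0 U0 ->
  (forall F U e x, F \subset H -> {in F, forall e, e \subset U} -> P F U ->
     e \in H -> e \notin F -> x \in e -> x \in U -> ~~ (e \subset U) ->
     P (e |: F) (U :|: e)) ->
  exists F U, [/\ F \subset H, {in F, forall e, e \subset U}, P F U &
                 edge_closed H U].
Proof.
move=> F0H F0U P0 step.
elim: {U0}_.+1 {-2}U0 (ltnSn #|~: U0|) F0 F0H F0U P0 => // n IH U.
rewrite ltnS => cU F FH FU PFU.
have [iso|] := boolP (edge_closed H U); first by exists F, U.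
rewrite negb_forall => /existsP[e]; rewrite negb_imply => /andP[eH].
rewrite negb_imply => /andP[/existsP[x /andP[xe xU]] eU].
have eF : e \notin F by apply: contra eU => /FU.
apply: (IH (U :|: e) _ (e |: F)).
- apply: leq_trans cU; apply: proper_card.
  rewrite properE setCS subsetUl /= setCS; apply: contra eU => /subsetP h.
  by apply/subsetP => y ye; apply: h; rewrite inE ye orbT.
- by rewrite subUset sub1set eH.
- move=> f; rewrite !inE => /orP[/eqP->|/FU fU]; first exact: subsetUr.
  exact: subset_trans fU (subsetUl _ _).
- exact: (step F U e x).
Qed.

Lemma hadjacent_sym H : symmetric (hadjacent H).
Proof.
by move=> x y; apply/existsP/existsP => -[e /and3P[eH xe ye]]; exists e;
  apply/and3P.
Qed.

Lemma hconnect_sym H : connect_sym (hadjacent H).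
Proof. exact: sym_connect_sym (hadjacent_sym H). Qed.

Lemma hadjacentP H x y :
  reflect (exists e, [/\ e \in H, x \in e & y \in e]) (hadjacent H x y).
Proof.
apply: (iffP existsP) => -[e]; first by case/and3P; exists e.
by move=> [eH xe ye]; exists e; apply/and3P.
Qed.

Lemma sub_hconnect F H : F \subset H ->
  subrel (connect (hadjacent F)) (connect (hadjacent H)).
Proof.
move=> /subsetP FH; apply: connect_sub => x y /hadjacentP[e [eF xe ye]].
by apply: connect1; apply/hadjacentP; exists e; split=> //; apply: FH.
Qed.

Definition component_of H x := [set y | connect (hadjacent H) x y].

Lemma component_of_refl H x : x \in component_of H x. Proof. by rewrite inE connect0. Qed.

Lemma componentsP H C :
  reflect (exists x, C = component_of H x) (C \in components H).
Proof.
apply: (iffP imsetP) => [[x _ ->]|[x ->]]; exists x; rewrite ?inE //;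
  by apply/setP => y; rewrite !inE.
Qed.

Lemma component_of_eq H x y : y \in component_of H x -> component_of H x = component_of H y.
Proof.
rewrite inE => xy; apply/setP => z; rewrite !inE.
exact: same_connect (hconnect_sym H) _ _ xy z.
Qed.

Lemma edge_closed_component_of H x : edge_closed H (component_of H x).
Proof.
apply/edge_closedP => e y eH ye; rewrite inE => xy; apply/subsetP => z ze.
rewrite inE; apply: connect_trans xy (connect1 _).
by apply/hadjacentP; exists e.
Qed.

Lemma component_of_sub H U x : edge_closed H U -> x \in U -> component_of H x \subset U.
Proof.
move=> /edge_closedP iso xU; apply/subsetP => y; rewrite inE => /connectP[s].
elim: s x xU => [|z s IH] x xU /=; first by move=> _ ->.
move=> /andP[/hadjacentP[e [eH xe ze]] pz ylast]; apply: (IH z) => //.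
exact: (subsetP (iso _ _ eH xe xU)).
Qed.

Lemma hconnected_edge_closed H U : hconnected H -> edge_closed H U ->
  U != finset.set0 -> U = [set: V].
Proof.
move=> [_ conn] iso /set0Pn[x xU]; apply/setP => y; rewrite inE.
by apply: (subsetP (component_of_sub iso xU)); rewrite inE.
Qed.

Lemma card_crossU U e x : x \in e -> x \in U -> ~~ (e \subset U) ->
  #|U| < #|U :|: e| <= #|U| + #|e|.-1.
Proof.
move=> xe xU eU; apply/andP; split.
  apply: proper_card; rewrite properE subsetUl /=; apply: contra eU => h.
  exact: subset_trans (subsetUr _ _) h.
have := cardsUI U e; have : 0 < #|U :&: e|.
  by apply/card_gt0P; exists x; rewrite inE xU.
have : 0 < #|e| by apply/card_gt0P; exists x.
lia.
Qed.

Lemma connect_crossU F U e x :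
  x \in e -> x \in U -> {in U &, forall y z, connect (hadjacent F) y z} ->
  {in U :|: e &, forall y z, connect (hadjacent (e |: F)) y z}.
Proof.
move=> xe xU conU.
have key y : y \in U :|: e -> connect (hadjacent (e |: F)) x y.
  rewrite inE => /orP[yU|ye].
    by apply: sub_hconnect (conU x y xU yU); apply: subsetUr.
  by apply: connect1; apply/hadjacentP; exists e; rewrite setU11.
move=> y z yU zU; apply: connect_trans (key z zU).
by rewrite hconnect_sym key.
Qed.

(** Grow from the single vertex x: each new edge contributes at least one and at
    most d new vertices, which gives both bounds. *)
Lemma spanning_subgraph d H x : uniform d.+1 H ->
  exists F, [/\ F \subset H, component_of F x = component_of H x, #|F| < #|component_of H x|,
    {in F, forall e, e \subset component_of H x} & #|component_of H x| <= 1 + d * #|F|].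
Proof.
move=> uH.
pose P F U := [/\ x \in U, {in U &, forall y z, connect (hadjacent F) y z},
  #|F| < #|U| & #|U| <= 1 + d * #|F|].
have [||||F [U [FH FU [xU con FltU leU] iso]]] :=
  @saturate H P finset.set0 [set x].
- exact: sub0set.
- by move=> e; rewrite inE.
- split; rewrite ?inE ?cards0 ?cards1 //.
  by move=> y z; rewrite !inE => /eqP-> /eqP->.
- move=> F U e y FH FU [xU con FltU leU] eH eF ye yU eU; split.
  + by rewrite inE xU.
  + exact: connect_crossU ye yU con.
  + have /andP[h _] := card_crossU ye yU eU.
    by rewrite cardsU1 eF; apply: leq_ltn_trans FltU h.
  + have /andP[_ h] := card_crossU ye yU eU.
    apply: leq_trans h _; rewrite (uH e eH) cardsU1 eF mulnDr muln1 addnCA.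
    by rewrite [X in X <= _]addnC leq_add2l.
have UE : U = component_of H x.
  apply/eqP; rewrite eqEsubset component_of_sub // andbT; apply/subsetP => y yU.
  by rewrite inE (sub_hconnect FH) // con.
exists F; rewrite -UE; split=> //.
apply/eqP; rewrite eqEsubset component_of_sub //=; last first.
  apply/edge_closedP => e y eF _ _; exact: FU.
by apply/subsetP => y yU; rewrite inE con.
Qed.

Lemma incidence_connect F x y : connect (hadjacent F) x y ->
  connect (incidence F) (inl x) (inl y).
Proof.
move=> /connectP[s]; elim: s x => [|z s IH] x /=; first by move=> _ ->.
move=> /andP[/hadjacentP[e [eF xe ze]] pz yl].
apply: connect_trans (IH z pz yl); apply: connect_trans (_ : connect _ _ (inr e)) _.
  by apply: connect1; rewrite /= eF xe.
by apply: connect1; rewrite /= eF ze.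
Qed.

(** A path avoiding the edge e between two of its vertices closes up, through
    e, to a cycle of the incidence graph. *)
Lemma acyclic_attach F H e x y : F \subset H -> berge_acyclic H ->
  e \in H -> e \notin F -> x \in e -> y \in e ->
  connect (hadjacent F) x y -> x = y.
Proof.
move=> FH acy eH eF xe ye /incidence_connect /connectP[s ps ylast].
case/shortenP: ps ylast => {}s ps us _ ylast.
apply/eqP; apply: contraT => xy.
have: size (inr e :: inl x :: s) <= 2.
  apply: acy; rewrite /ucycle /cycle /= rcons_path -ylast /= eH xe ye /=.
  rewrite andbT; apply/andP; split.
    apply: sub_path ps => -[v|f] [w|g] //= /andP[h ->];
    by rewrite (subsetP FH).
  rewrite inE negb_or /=; move: us => /= ->; rewrite andbT.
  apply/negP => es.
  have: all [pred z | if z is inr f then f \in F else true] s.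
    elim: s (inl x : V + {set V}) ps {ylast es} => //= z s IH w /andP[wz pz].
    rewrite (IH z) // andbT; case: z w wz {pz} => [//|f] [v|//] /= /andP[-> //].
  by move=> /allP /(_ _ es) /=; rewrite (negbTE eF).
case: s ps us ylast => [|a s] ps us ylast //.
by move: ylast xy => /= [->]; rewrite eqxx.
Qed.

(** Growing from a vertex, acyclicity forces each new edge to meet the old
    vertices in one point only, so it contributes exactly d vertices; no edge is
    left over at the end, because it would close a cycle. *)
Lemma acyclic_card d H : 0 < d -> hconnected H -> berge_acyclic H ->
  uniform d.+1 H -> #|V| = 1 + d * #|H|.
Proof.
move=> d0 con acy uH; have [/card_gt0P[x _] conH] := con.
pose P F U := [/\ x \in U, {in U &, forall y z, connect (hadjacent F) y z} &
   #|U| = 1 + d * #|F|].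
have [||||F [U [FH FU [xU conU cU] iso]]] :=
  @saturate H P finset.set0 [set x].
- exact: sub0set.
- by move=> e; rewrite inE.
- split; rewrite ?inE ?cards0 ?cards1 ?muln0 //.
  by move=> y z; rewrite !inE => /eqP-> /eqP->.
- move=> F U e y FH FU [xU conU cU] eH eF ye yU eU; split.
  + by rewrite inE xU.
  + exact: connect_crossU ye yU conU.
  + have Ie : U :&: e = [set y].
      apply/setP => z; rewrite !inE; apply/andP/eqP => [[zU ze]|->//].
      by apply: (acyclic_attach FH acy eH eF ze ye); apply: conU.
    have := cardsUI U e; rewrite Ie cards1 (uH e eH) cardsU1 eF cU addn1 addnS => -[->].
    by rewrite mulnDr muln1 -addnA [(_ + d)%N]addnC.
have UT : U = [set: V].
  by apply: hconnected_edge_closed iso _ => //; apply/set0Pn; exists x.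
suff -> : H = F by rewrite -cU UT cardsT.
apply/eqP; rewrite eqEsubset FH andbT; apply/subsetP => e eH.
apply: contraT => eF; have /card_gt1P[y [z [ye ze]]] : 1 < #|e| by rewrite uH.
rewrite (acyclic_attach FH acy eH eF ye ze) ?eqxx //.
by apply: conU; rewrite UT inE.
Qed.

End Combinatorics.

(** * Butterflies are the connected hypergraphs with the fewest edges *)
Section Butterflies.
Import mathcomp.boot.fintype mathcomp.boot.finset.
Local Open Scope nat_scope.

Lemma next_neq_prev (T : eqType) (s : seq T) (z : T) :
  uniq s -> 2 < size s -> z \in s -> next s z != prev s z.
Proof.
move=> us ss zs; have [i t rt] := rot_to zs.
rewrite -(next_rot i us) -(prev_rot i us).
move: us ss; rewrite -(rot_uniq i) -(size_rot i s) rt.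
case: t {rt} => [//|y [//|w t]] us _.
apply/eqP => npz; have := next_prev us z; rewrite -npz /next /= eqxx.
move: us => /= /and3P[zt _ _]; move: zt; rewrite !inE !negb_or.
by case/and3P => zy zw _; rewrite eq_sym (negbTE zy) eqxx => wz; rewrite wz eqxx in zw.
Qed.

Lemma leq_card_bigcup (T I : finType) (P : pred I) (F : I -> {set T}) :
  #|\bigcup_(i | P i) F i| <= \sum_(i | P i) #|F i|.
Proof.
elim/big_ind2 : _ => [|A a B b hA hB|//]; first by rewrite cards0.
apply: leq_trans (leq_add hA hB).
exact: leq_card_setU.
Qed.

Variable V : finType.
Implicit Types (H F J : hypergraph V) (U C e : {set V}).

(** The r edges of a cycle of the incidence graph cover at most r * d vertices,
    one less than the r edges of a butterfly do. *)
Lemma cycle_card d H (s : seq (V + {set V})) : uniform d.+1 H -> ucycle (incidence H) s ->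
  2 < size s ->
  exists A : {set {set V}}, [/\ A \subset H, A != finset.set0 &
    #|\bigcup_(e in A) e| <= d * #|A|].
Proof.
move=> uH /andP[cs us] ss.
pose A := [set e : {set V} | inr e \in s]; pose W := [set v : V | inl v \in s].
have sN z : z \in s -> incidence H z (next s z) := next_cycle cs.
have sP z : z \in s -> incidence H (prev s z) z := prev_cycle cs.
have AW e : e \in A -> (e \in H) /\ 1 < #|e :&: W|.
  rewrite inE => es.
  have [v pE] : exists v, prev s (inr e) = inl v.
    by case: (prev s _) (sP _ es) => [v|//]; exists v.
  have [w nE] : exists w, next s (inr e) = inl w.
    by case: (next s _) (sN _ es) => [w|//]; exists w.
  have vs : inl v \in s by rewrite -pE mem_prev.
  have ws : inl w \in s by rewrite -nE mem_next.
  have vw := next_neq_prev us ss es; rewrite pE nE in vw.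
  have := sP _ es; have := sN _ es; rewrite pE nE /=.
  move=> /andP[_ we] /andP[eH ve]; split=> //; apply/card_gt1P.
  exists v, w; rewrite !inE vs ws ve we; split=> //.
  by apply: contra_neq vw => ->.
have WA : #|W| <= #|A|.
  pose f v := if next s (inl v) is inr e then e else finset.set0.
  have fE v : v \in W -> next s (inl v) = inr (f v).
    by rewrite inE /f => /sN; case: (next s _).
  rewrite -(@card_in_imset _ _ f W).
    apply: subset_leq_card; apply/subsetP => _ /imsetP[v vW ->].
    by rewrite inE -fE // mem_next; rewrite inE in vW.
  move=> v w vW wW fvw; apply: (inl_inj : injective (@inl V {set V})).
  by apply: (can_inj (prev_next us)); rewrite !fE // fvw.
exists A; split.
- by apply/subsetP => e /AW[].
- case: s ss @A @W {cs us AW WA} sN {sP} => [//|[v|e] s] _ A W sN; last first.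
    by apply/set0Pn; exists e; rewrite inE mem_head.
  have := sN _ (mem_head _ _); have := mem_head (inl v) s; rewrite -mem_next.
  by case: (next _ _) => // e es _; apply/set0Pn; exists e; rewrite inE.
have sub : \bigcup_(e in A) e \subset W :|: \bigcup_(e in A) (e :\: W).
  apply/subsetP => v /bigcupP[e eA ve]; rewrite inE.
  have [//|vW /=] := boolP (v \in W).
  by apply/bigcupP; exists e; rewrite // inE vW.
apply: leq_trans (subset_leq_card sub) _.
apply: leq_trans (leq_card_setU _ _) _.
apply: leq_trans (leq_add WA (leq_card_bigcup _ _)) _.
apply: (@leq_trans (#|A| + \sum_(e in A) d.-1)).
  rewrite leq_add2l; apply: leq_sum => e /AW[eH e2].
  by rewrite cardsD (uH e eH); lia.
rewrite sum_nat_const.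
have [/eqP|A0] := posnP #|A|; first by rewrite cards_eq0 => /eqP ->; rewrite cards0 mul0n.
have [e /AW[eH e2]] : exists e, e \in A by apply/card_gt0P.
have : 1 < d.+1 by rewrite -(uH e eH); apply: leq_trans e2 (subset_leq_card (subsetIl _ _)).
by case: (d) => // d' _; rewrite mulnC -mulSn.
Qed.

(** If there were a cycle, growing from its edges, which cover too few vertices,
    would give at most d vertices per edge in total. *)
Lemma card_acyclic d H : hconnected H -> uniform d.+1 H ->
  #|V| = 1 + d * #|H| -> berge_acyclic H.
Proof.
move=> con uH cV s cs; rewrite leqNgt; apply/negP => ss.
have [A [AH A0 cA]] := cycle_card uH cs ss.
pose P F U := U != finset.set0 /\ #|U| <= d * #|F|.
have [||||F [U [FH _ [U0 cU] iso]]] := @saturate V H P A (\bigcup_(e in A) e) => //.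
- by move=> e eA; apply: bigcup_sup.
- split=> //; have [e eA] := set0Pn _ A0.
  have /card_gt0P[v ve] : 0 < #|e| by rewrite (uH e) // (subsetP AH).
  by apply/set0Pn; exists v; apply/bigcupP; exists e.
- move=> F U e y FH FU [U0 cU] eH eF ye yU eU; split.
    by apply/set0Pn; exists y; rewrite inE yU.
  have /andP[_ h] := card_crossU ye yU eU.
  apply: leq_trans h _; rewrite (uH e eH) cardsU1 eF mulnDr muln1 addnC.
  by rewrite leq_add2l.
have UT := hconnected_edge_closed con iso U0.
have := leq_trans cU (leq_mul (leqnn d) (subset_leq_card FH)).
by rewrite UT cardsT cV ltnn.
Qed.

End Butterflies.

(** * Components as induced hypergraphs *)
Section SubHypergraph.
Import mathcomp.boot.fintype mathcomp.boot.finset.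
Local Open Scope nat_scope.
Variable V : finType.
Implicit Types (H F J : hypergraph V) (U C e : {set V}).

Definition edges_in H C : hypergraph V := [set e in H | e \subset C].

Lemma val_imset_preim (C e : {set V}) : e \subset C ->
  e = val @: [set v : {v : V | v \in C} | val v \in e].
Proof.
move=> eC; apply/setP => v; apply/idP/imsetP => [ve|[w we ->]].
  by exists (Sub v (subsetP eC v ve)); rewrite ?inE SubK.
by rewrite inE in we.
Qed.

Lemma sub_uniform r H C : uniform r H -> uniform r (sub_hypergraph H C).
Proof.
by move=> uH e; rewrite inE => /uH; rewrite card_imset //; apply: val_inj.
Qed.

Lemma card_sub_hypergraph H C : #|sub_hypergraph H C| = #|edges_in H C|.
Proof.
have inj : injective (fun e : {set {v : V | v \in C}} => val @: e).
  by apply: imset_inj; apply: val_inj.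
rewrite -(card_imset (mem (sub_hypergraph H C)) inj); apply: eq_card => e.
rewrite inE; apply/imsetP/andP => [[f]|[eH eC]].
  rewrite inE => fH ->; split=> //; apply/subsetP => _ /imsetP[v _ ->].
  exact: valP.
exists [set v : {v : V | v \in C} | val v \in e]; last exact: val_imset_preim.
by rewrite inE -val_imset_preim.
Qed.

Lemma sub_connected H C : C \in components H -> hconnected (sub_hypergraph H C).
Proof.
move=> /componentsP[x CE]; split.
  have xC : x \in C by rewrite CE component_of_refl.
  by apply/card_gt0P; exists (Sub x xC).
have iso : edge_closed H C by rewrite CE; apply: edge_closed_component_of.
have key (a b : V) (a' : {v : V | v \in C}) : connect (hadjacent H) a b -> val a' = a ->
    exists2 b', val b' = b & connect (hadjacent (sub_hypergraph H C)) a' b'.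
  move=> /connectP[s]; elim: s a a' => [|z s IH] a a' /=.
    by move=> _ -> <-; exists a'.
  move=> /andP[/hadjacentP[e [eH ae ze]] pz bl] aa'.
  have aC : a \in C by rewrite -aa' (valP a').
  have eC : e \subset C by apply: (edge_closedP _ _ iso) eH ae aC.
  have zC : z \in C by apply: (subsetP eC).
  have [b' b'E zb'] := IH z (Sub z zC) pz bl (SubK _ _).
  exists b' => //; apply: connect_trans zb'; apply: connect1; apply/hadjacentP.
  exists [set v : {v : V | v \in C} | val v \in e].
  by split; rewrite inE -?val_imset_preim ?SubK //; move: ae; rewrite -aa'.
have xC w : w \in C -> connect (hadjacent H) x w by rewrite CE inE.
move=> u v; have uv : connect (hadjacent H) (val u) (val v).
  apply: connect_trans (xC _ (valP v)); rewrite hconnect_sym.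
  exact: xC (valP u).
by have [b' /val_inj->] := key (val u) (val v) u uv erefl.
Qed.

Lemma component_butterfly d H C : C \in components H -> uniform d.+1 H ->
  #|C| = 1 + d * #|edges_in H C| -> butterfly d (sub_hypergraph H C).
Proof.
move=> Cc uH cC.
have con := sub_connected Cc.
have uS : uniform d.+1 (sub_hypergraph H C) by exact: sub_uniform.
have acy := card_acyclic con uS.
split=> //; apply: acy.
by rewrite card_sub_hypergraph -cC card_sig; apply: eq_card.
Qed.

Lemma component_card d H C : C \in components H -> uniform d.+1 H ->
  #|C| <= 1 + d * #|edges_in H C|.
Proof.
move=> /componentsP[x ->] uH; have [F [FH _ _ FC cC]] := spanning_subgraph x uH.
apply: leq_trans cC _; rewrite leq_add2l leq_mul2l; apply/orP; right.
by apply: subset_leq_card; apply/subsetP => e eF; rewrite inE (subsetP FH) //= FC.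
Qed.

End SubHypergraph.

(** * Recognizing components *)
Section Components.
Import mathcomp.boot.fintype mathcomp.boot.finset.
Local Open Scope nat_scope.
Variable V : finType.
Implicit Types (H F J K : hypergraph V) (U C S T e : {set V}).

(** The few edges of M already hold the component S together, and removing
    edges of K does not create edges leaving S. *)
Lemma component_witness d K S : uniform d.+1 K -> S \in components K ->
  exists M : hypergraph V, [/\ M \subset K, #|M| < #|S| &
    forall J : hypergraph V, M \subset J -> J \subset K -> S \in components J].
Proof.
move=> uK /componentsP[x ->].
have [M [MK cM MS _ _]] := spanning_subgraph x uK; exists M; split=> // J MJ JK.
apply/componentsP; exists x; apply/eqP; rewrite eqEsubset; apply/andP; split.
  rewrite -cM; apply/subsetP => y; rewrite !inE; exact: sub_hconnect.
by apply/subsetP => y; rewrite !inE; apply: sub_hconnect.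
Qed.

Lemma component_edge_closed H C : C \in components H -> edge_closed H C.
Proof. by move=> /componentsP[x ->]; apply: edge_closed_component_of. Qed.

Lemma component_gt0 H C : C \in components H -> 0 < #|C|.
Proof.
by move=> /componentsP[x ->]; apply/card_gt0P; exists x; apply: component_of_refl.
Qed.

Lemma component_edge_closed_sub H C U x : C \in components H -> edge_closed H U ->
  x \in C -> x \in U -> C \subset U.
Proof.
by move=> /componentsP[y ->] iso xC xU; rewrite (component_of_eq xC); apply: component_of_sub.
Qed.

Lemma component_eq H C D x : C \in components H -> D \in components H ->
  x \in C -> x \in D -> C = D.
Proof.
move=> hC hD xC xD; have iC := component_edge_closed hC.
have iD := component_edge_closed hD; apply/eqP; rewrite eqEsubset.
by rewrite (component_edge_closed_sub hC iD xC xD) (component_edge_closed_sub hD iC xD xC).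
Qed.

Lemma card_component_pair H C D : C \in components H -> D \in components H ->
  C != D -> #|C| + #|D| <= #|V|.
Proof.
move=> hC hD CD; have I0 : C :&: D = finset.set0.
  apply/eqP; rewrite setI_eq0 disjoint_subset; apply/subsetP => x xC; rewrite !inE.
  by apply: contra CD => xD; rewrite (component_eq hC hD xC xD).
by have := cardsUI C D; rewrite I0 cards0 addn0 => <-; apply: max_card.
Qed.

(** If all components had at most n/2 vertices, collecting components greedily
    would produce a union of components between n/4 and n/2. *)
Lemma giant_component H N : #|V| = N ->
  (forall T, edge_closed H T -> N <= 4 * #|T| -> 2 * #|T| <= N -> False) ->
  exists2 L, L \in components H & N < 2 * #|L|.
Proof.
move=> cV noT; have [/exists_inP[L Lc L2]|] :=
  boolP [exists L in components H, N < 2 * #|L|].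
  by exists L.
rewrite negb_exists_in => /forall_inP small.
pose P T := edge_closed H T && (2 * #|T| <= N).
have P0 : P finset.set0.
  by rewrite /P cards0 muln0 andbT; apply/edge_closedP => e x _ _; rewrite inE.
have [T /andP[isoT T2] maxT] := arg_maxnP (fun T => #|T|) P0.
have [|T4] := leqP N (4 * #|T|); first by move=> /(noT T isoT) /(_ T2).
have [x xT] : exists x, x \in ~: T.
  by apply/card_gt0P; have := cardsC T; rewrite cV; lia.
rewrite inE in xT.
have xc : component_of H x \in components H by apply/componentsP; exists x.
have isox := edge_closed_component_of H x; have := small _ xc; rewrite -leqNgt => x2.
have [|x4] := leqP N (4 * #|component_of H x|); first by move=> /(noT _ isox) /(_ x2).
have leU : #|T :|: component_of H x| <= #|T| + #|component_of H x| by apply: leq_card_setU.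
have /maxT : P (T :|: component_of H x).
  rewrite /P edge_closedU //=; apply: leq_trans (leq_mul (leqnn 2) leU) _.
  by move: T4 x4; clear; lia.
rewrite /= leqNgt proper_card // properE subsetUl /=.
by apply: contra xT => /subsetP; apply; rewrite inE component_of_refl orbT.
Qed.

(** The events to which the second moment method is applied: the conditions on
    H only prescribe which edges meeting S are present, namely those of the copy
    G of B. *)
Lemma butterfly_copy d m (B : hypergraph 'I_m) S :
  hconnected B -> uniform d.+1 B -> #|S| = m ->
  exists G : {set {set V}}, [/\ #|G| = #|B|,
    {in G, forall e : {set V}, e \subset S /\ #|e| = d.+1} &
    forall H, uniform d.+1 H -> G \subset H ->
      (forall e x, e \in H -> x \in e -> x \in S -> e \in G) ->
      S \in components H /\ isomorphic B (sub_hypergraph H S)].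
Proof.
move=> [m0 conB] uB cS; rewrite card_ord in m0.
have cT : #|{: {v : V | v \in S}}| = m by rewrite card_sig -cS; apply: eq_card.
pose g (i : 'I_m) : {v : V | v \in S} := enum_val (cast_ord (esym cT) i).
have gi : injective g by move=> i j /enum_val_inj /cast_ord_inj.
have gb : bijective g by apply: inj_card_bij; rewrite // card_ord cT.
pose f i := val (g i).
have fi : injective f by apply: inj_comp gi; apply: val_inj.
have fS i : f i \in S := valP (g i).
have onto y : y \in S -> exists i, y = f i.
  move=> yS; have [h _ hK] := gb.
  by exists (h (Sub y yS)); rewrite /f hK SubK.
exists [set f @: (b : {set 'I_m}) | b in B]; split.
- by rewrite card_imset //; apply: imset_inj.
- move=> _ /imsetP[b bB ->]; split; last by rewrite card_imset // uB.
  by apply/subsetP => _ /imsetP[i _ ->].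
move=> H uH GH touch.
have isoS : edge_closed H S.
  apply/edge_closedP => e x eH xe xS; have /imsetP[b _ ->] := touch e x eH xe xS.
  by apply/subsetP => _ /imsetP[i _ ->].
have conf i j : connect (hadjacent B) i j -> connect (hadjacent H) (f i) (f j).
  move=> /connectP[s]; elim: s i => [|k s IH] i /=; first by move=> _ ->.
  move=> /andP[/hadjacentP[b [bB ib kb]] pk jl].
  apply: connect_trans (IH k pk jl); apply: connect1; apply/hadjacentP.
  exists (f @: b); rewrite !mem_imset //; split=> //.
  by apply: (subsetP GH); apply: imset_f.
pose i0 := Ordinal m0; split.
  apply/componentsP; exists (f i0); apply/eqP; rewrite eqEsubset component_of_sub // andbT.
  by apply/subsetP => y /onto[i ->]; rewrite inE conf.
exists g => // e; rewrite inE -imset_comp.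
have -> : (val \o g) @: e = f @: e by [].
apply/idP/idP => [eH|eB]; last by apply: (subsetP GH); apply: imset_f.
have : 0 < #|f @: e| by rewrite (uH _ eH).
case/card_gt0P => _ /imsetP[i ie _].
have /imsetP[b bB] := touch _ _ eH (imset_f f ie) (fS i).
by move=> /(imset_inj fi) ->.
Qed.

End Components.

(** * Random subsets with independent elements *)
Section ProductMeasure.
Import mathcomp.boot.fintype mathcomp.boot.finset.
Variables (R : realType) (T : finType).
Implicit Types (w r : T -> R) (A B : {set T} -> Prop) (H J K F D M : {set T}).

(** The element i belongs to the random set with probability w i.  Varying this
    probability with i is what allows different thinning rates for different
    elements. *)
Definition weight w H : R := \prod_i (if i \in H then w i else 1 - w i).

Definition product_prob w A : R := \sum_(H : {set T} | `[< A H >]) weight w H.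

Definition probs w := forall i, 0 <= w i <= 1.

Lemma weight_ge0 w H : probs w -> 0 <= weight w H.
Proof.
move=> w01; apply: prodr_ge0 => i _; have /andP[w0 w1] := w01 i.
by case: ifP; rewrite ?subr_ge0.
Qed.

Lemma product_prob_ge0 w A : probs w -> 0 <= product_prob w A.
Proof. by move=> w01; apply: sumr_ge0 => H _; apply: weight_ge0. Qed.

Lemma sum_subsets (f g : T -> R) :
  \sum_(J : {set T}) \prod_i (if i \in J then f i else g i) = \prod_i (f i + g i).
Proof. by rewrite bigA_distr; apply: eq_bigl => J. Qed.

Lemma sum_weight w : \sum_(H : {set T}) weight w H = 1.
Proof.
by rewrite sum_subsets big1 // => i _; rewrite addrC subrK.
Qed.

Lemma product_probE w A : product_prob w A = \sum_(H : {set T}) weight w H * `[< A H >]%:R.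
Proof.
by rewrite /product_prob big_mkcond /=; apply: eq_bigr => H _; case: ifP; rewrite (mulr1, mulr0).
Qed.

Lemma product_prob_le w A B : probs w -> (forall H, A H -> B H) -> product_prob w A <= product_prob w B.
Proof.
move=> w01 AB; rewrite !product_probE; apply: ler_sum => H _.
rewrite ler_wpM2l ?weight_ge0 //; case: asboolP => [/AB h|_]; last exact: ler0n.
by rewrite asboolT.
Qed.

Lemma product_probC w A : product_prob w A + product_prob w (fun H => ~ A H) = 1.
Proof.
rewrite !product_probE -big_split /= -[RHS](sum_weight w); apply: eq_bigr => H _.
by rewrite asbool_neg -mulrDr; case: `[< A H >]; rewrite (addr0, add0r) mulr1.
Qed.

Lemma product_prob_union (I : finType) (P : pred I) w A (B : I -> {set T} -> Prop) :
  probs w -> (forall H, A H -> exists2 i, P i & B i H) ->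
  product_prob w A <= \sum_(i | P i) product_prob w (B i).
Proof.
move=> w01 AB; under eq_bigr do rewrite product_probE.
rewrite exchange_big /= product_probE; apply: ler_sum => H _.
rewrite -mulr_sumr ler_wpM2l ?weight_ge0 //.
case: asboolP => [/AB[i Pi Bi]|_]; last by apply: sumr_ge0 => i _; apply: ler0n.
by rewrite (bigD1 i) //= asboolT // lerDl sumr_ge0 // => j _; apply: ler0n.
Qed.

Lemma product_prob_cylinder w F D : [disjoint F & D] ->
  product_prob w (fun H => F \subset H /\ [disjoint H & D]) =
  \prod_(i in F) w i * \prod_(i in D) (1 - w i).
Proof.
move=> FD.
transitivity (\sum_(J : {set T}) \prod_i (if i \in J then (if i \in D then 0 else w i)
                              else (if i \in F then 0 else 1 - w i))).
  rewrite /product_prob big_mkcond /=; apply: eq_bigr => J _.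
  case: asboolP => [[/subsetP FJ JD]|nJ].
    apply: eq_bigr => i _; case: ifPn => [iJ|]; first by rewrite (disjointFr JD iJ).
    by move=> iJ; rewrite ifN //; apply: contra iJ => /FJ.
  have [FJ|/subsetPn[i iF iJ]] := boolP (F \subset J); last first.
    by rewrite (bigD1 i) //= (negbTE iJ) iF mul0r.
  have : ~~ [disjoint J & D] by apply/negP => JD; apply: nJ.
  rewrite disjoint_subset => /subsetPn[i iJ].
  by rewrite !inE negbK => iD; rewrite (bigD1 i) //= iJ iD mul0r.
rewrite sum_subsets (big_mkcond (mem F)) (big_mkcond (mem D)) -big_split /=.
apply: eq_bigr => i _; have [iF|iF] := boolP (i \in F).
  by rewrite (disjointFr FD iF) addr0 mulr1.
by case: ifP => _; rewrite ?add0r ?mul1r // addrC subrK.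
Qed.

(** Keep each element of a random set of law p independently with probability
    r: the result J has law p * r, and it lies between M and K with conditional
    probability the product of r over M. *)
Lemma thinning (p r : T -> R) (rho : R) A :
  probs p -> probs r ->
  (forall K, A K -> exists M, [/\ M \subset K, rho <= \prod_(i in M) r i &
     forall J, M \subset J -> J \subset K -> A J]) ->
  rho * product_prob p A <= product_prob (fun i => p i * r i) A.
Proof.
move=> p01 r01 convA.
pose g J K := \prod_i (if i \in K then p i * (if i \in J then r i else 1 - r i)
                       else if i \in J then 0 else 1 - p i).
have gE J : weight (fun i => p i * r i) J = \sum_(K : {set T}) g J K.
  rewrite sum_subsets; apply: eq_bigr => i _.
  by case: ifP => _; rewrite ?addr0 //; ring.
have g0 J K : 0 <= g J K.
  apply: prodr_ge0 => i _; have /andP[a b] := p01 i; have /andP[c e] := r01 i.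
  by do 2!case: ifP => _; rewrite ?mulr_ge0 ?subr_ge0.
rewrite /product_prob mulr_sumr; under [leRHS]eq_bigr do rewrite gE.
rewrite [leRHS]exchange_big /= big_mkcond /=; apply: ler_sum => K _.
case: asboolP => [/convA[M [/subsetP MK rhoM conv]]|_]; last exact: sumr_ge0.
apply: (@le_trans _ _ (weight p K * \prod_(i in M) r i)).
  by rewrite mulrC ler_wpM2l // weight_ge0.
pose gM J := \prod_i (if i \in J then (if i \in K then p i * r i else 0) else
   (if i \in M then 0 else if i \in K then p i * (1 - r i) else 1 - p i)).
have -> : weight p K * \prod_(i in M) r i = \sum_(J : {set T}) gM J.
  rewrite sum_subsets (big_mkcond (mem M)) -big_split /=; apply: eq_bigr => i _.
  have [/MK ->|_] := boolP (i \in M); first by rewrite addr0.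
  by case: ifP => _; ring.
rewrite [leRHS]big_mkcond /=; apply: ler_sum => J _.
have [MJ|/subsetPn[i iM iJ]] := boolP (M \subset J); last first.
  rewrite /gM (bigD1 i) //= (negbTE iJ) iM mul0r.
  by case: ifP => _.
have [JK|/subsetPn[i iJ iK]] := boolP (J \subset K); last first.
  rewrite /gM (bigD1 i) //= iJ (negbTE iK) mul0r.
  by case: ifP => _.
rewrite asboolT; last exact: conv.
apply: ler_prod => i _; have /andP[a b] := p01 i; have /andP[c e] := r01 i.
case: ifP => iJ; case: ifP => iK; rewrite ?lexx ?andbT ?mulr_ge0 //.
  by rewrite (subsetP MJ _ iK) in iJ.
by case: ifP => _; rewrite ?lexx ?mulr_ge0 ?subr_ge0.
Qed.

(** Chebyshev's inequality for the number of events that occur, when distinct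
    events are almost uncorrelated. *)
Lemma second_moment (I : finType) (P : pred I) w (B : I -> {set T} -> Prop)
    (k : nat) (eps : R) :
  probs w -> 0 <= eps ->
  (forall i j, P i -> P j -> i != j ->
    product_prob w (fun H => B i H /\ B j H) <= (1 + eps) * (product_prob w (B i) * product_prob w (B j))) ->
  0 < \sum_(i | P i) product_prob w (B i) ->
  2 * k%:R <= \sum_(i | P i) product_prob w (B i) ->
  product_prob w (fun H => (#|[set i | P i & `[< B i H >]]| < k)%N) <=
    4 / (\sum_(i | P i) product_prob w (B i)) + 4 * eps.
Proof.
set mu := \sum_(i | P i) _ => w01 eps0 cor mu0 kmu.
pose X H : R := \sum_(i | P i) `[< B i H >]%:R.
have XE H : X H = #|[set i | P i & `[< B i H >]]|%:R.
  rewrite /X -natr_sum -sum1_card big_mkcond [in RHS]big_mkcond /=; congr _%:R.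
  by apply: eq_bigr => i _; rewrite inE; case: (P i); case: `[< _ >].
have EX : \sum_(H : {set T}) weight w H * X H = mu.
  rewrite /mu; under [RHS]eq_bigr do rewrite product_probE.
  by rewrite exchange_big /=; apply: eq_bigr => H _; rewrite mulr_sumr.
have EX2 : \sum_(H : {set T}) weight w H * X H ^+ 2 <= mu + (1 + eps) * mu ^+ 2.
  have -> : \sum_(H : {set T}) weight w H * X H ^+ 2 =
     \sum_(i | P i) \sum_(j | P j) product_prob w (fun H => B i H /\ B j H).
    under [RHS]eq_bigr do under eq_bigr do rewrite product_probE.
    under [RHS]eq_bigr do rewrite exchange_big /=.
    rewrite exchange_big /=; apply: eq_bigr => H _.
    rewrite expr2 /X mulr_suml mulr_sumr; apply: eq_bigr => i _.
    rewrite !mulr_sumr; apply: eq_bigr => j _; congr (_ * _).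
    by rewrite asbool_and -natrM mulnb.
  have -> : mu + (1 + eps) * mu ^+ 2 = \sum_(i | P i) (product_prob w (B i) +
      \sum_(j | P j) (1 + eps) * (product_prob w (B i) * product_prob w (B j))).
    rewrite big_split /= -/mu; congr (_ + _).
    rewrite expr2 {1}/mu mulr_suml mulr_sumr; apply: eq_bigr => i _.
    by rewrite -mulr_sumr -mulr_sumr.
  apply: ler_sum => i Pi; rewrite (bigD1 i) //= [in leRHS](bigD1 i) //=.
  apply: lerD; first by apply: product_prob_le => // H [].
  rewrite -[leLHS]add0r; apply: lerD.
    by rewrite !mulr_ge0 ?product_prob_ge0 ?addr_ge0.
  by apply: ler_sum => j /andP[Pj ji]; apply: cor => //; rewrite eq_sym.
set LHS := product_prob _ _.
suff : LHS * (mu / 2) ^+ 2 <= mu + eps * mu ^+ 2.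
  rewrite -ler_pdivlMr ?exprn_gt0 ?divr_gt0 // => h; apply: le_trans h _.
  by rewrite le_eqVlt; apply/orP; left; apply/eqP; field; rewrite gt_eqF.
have -> : mu + eps * mu ^+ 2 = mu + (1 + eps) * mu ^+ 2 - mu ^+ 2 by ring.
apply: (@le_trans _ _ (\sum_(H : {set T}) weight w H * (X H - mu) ^+ 2)); last first.
  have -> : \sum_(H : {set T}) weight w H * (X H - mu) ^+ 2 =
     \sum_(H : {set T}) weight w H * X H ^+ 2 - mu ^+ 2; last by rewrite lerD2r.
  have sq (m : R) : \sum_(H : {set T}) weight w H * (X H - m) ^+ 2 =
      \sum_(H : {set T}) weight w H * X H ^+ 2 - 2 * m * (\sum_(H : {set T}) weight w H * X H)
      + m ^+ 2 * \sum_(H : {set T}) weight w H.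
    rewrite !mulr_sumr -sumrB -big_split /=; apply: eq_bigr => H _; ring.
  by rewrite sq EX sum_weight; ring.
rewrite /LHS product_probE mulr_suml; apply: ler_sum => H _.
rewrite -mulrA ler_wpM2l ?weight_ge0 //; case: asboolP => [Xk|_]; last by rewrite mul0r sqr_ge0.
have XH : X H <= k%:R by rewrite XE ler_nat ltnW.
rewrite mul1r -[leRHS]sqrrN opprB ler_sqr ?nnegrE; lra.
Qed.

End ProductMeasure.

(** * Counting potential edges *)
Section EdgeCounts.
Import mathcomp.boot.fintype mathcomp.boot.finset.
Local Open Scope nat_scope.
Variables (d n : nat).
Implicit Types (H F : {set {set 'I_n}}) (S T A e : {set 'I_n}).
Local Notation E := (potential_edges d n).

Lemma potential_uniform H : H \subset E -> uniform d.+1 H.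
Proof. by move=> /subsetP HE e /HE; rewrite inE => /eqP. Qed.

Definition crossing S := [set e in E | [exists x in e, x \in S] && ~~ (e \subset S)].

Definition touching S := [set e in E | [exists x in e, x \in S]].

Lemma edge_closed_crossing H S : H \subset E ->
  edge_closed H S <-> [disjoint H & crossing S].
Proof.
move=> /subsetP HE; rewrite disjoint_subset; split.
  move=> /edge_closedP iso; apply/subsetP => e eH; rewrite !inE.
  by apply/negP => /andP[_ /andP[/exists_inP[x xe xS]]]; rewrite (iso e x).
move=> /subsetP dis; apply/edge_closedP => e x eH xe xS; have := dis e eH.
rewrite !inE; have := HE _ eH; rewrite inE => ->.
have -> /= : [exists y in e, y \in S] by apply/exists_inP; exists x.
by rewrite negbK.
Qed.

(** Only the edges with a single vertex in S are counted. *)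
Lemma card_crossing S : 0 < d -> #|S| * 'C(n - #|S|, d) <= #|crossing S|.
Proof.
move=> d0; pose D := [set A : {set 'I_n} | A \subset ~: S & #|A| == d].
have cD : #|D| = 'C(n - #|S|, d).
  by rewrite cards_draws [#|~: S|]cardsCs setCK card_ord.
rewrite -cD -cardsX -(@card_in_imset _ _ (fun u : 'I_n * {set 'I_n} => u.1 |: u.2)).
  apply: subset_leq_card; apply/subsetP => z /imsetP[[x A] /setXP[/= xS]].
  rewrite inE => /andP[/subsetP AS /eqP cA] ->; rewrite !inE.
  have xA : x \notin A by apply/negP => /AS; rewrite inE xS.
  rewrite cardsU1 xA cA eqxx /=; apply/andP; split.
    by apply/exists_inP; exists x; rewrite ?setU11.
  have /card_gt0P[y yA] : 0 < #|A| by rewrite cA.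
  by apply/subsetPn; exists y; [rewrite inE yA orbT|have := AS _ yA; rewrite inE].
move=> [x A] [y B] /setXP[/= xS]; rewrite inE => /andP[/subsetP AS _].
move=> /setXP[/= yS]; rewrite inE => /andP[/subsetP BS _] /= /setP eqU.
have xB z : z \in S -> (z == x) = (z == y).
  move=> zS; have := eqU z; rewrite !inE.
  have /negbTE-> : z \notin A by apply/negP => /AS; rewrite inE zS.
  have /negbTE-> : z \notin B by apply/negP => /BS; rewrite inE zS.
  by rewrite !orbF.
have xy : x = y by apply/eqP; rewrite -xB // eqxx.
rewrite -xy in BS eqU *; congr (_, _); apply/setP => z.
have [zS|zS] := boolP (z \in S).
  have /negbTE-> : z \notin A by apply/negP => /AS; rewrite inE zS.
  by have /negbTE-> : z \notin B by apply/negP => /BS; rewrite inE zS.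
have zx : z == x = false by apply: contraNF zS => /eqP->.
by have := eqU z; rewrite !inE zx.
Qed.

Lemma card_containing A r :
  #|[set e : {set 'I_n} | A \subset e & #|e| == r + #|A|]| <= 'C(n, r).
Proof.
rewrite -[in leqRHS](card_ord n) -card_draws.
rewrite -(@card_in_imset _ _ (fun e : {set 'I_n} => e :\: A)).
  apply: subset_leq_card; apply/subsetP => z /imsetP[e].
  rewrite inE => /andP[Ae /eqP ce] ->.
  by rewrite inE cardsD (setIidPr Ae) ce addnK.
move=> e f; rewrite !inE => /andP[Ae _] /andP[Af _] ef.
by rewrite -(setID e A) -(setID f A) (setIidPr Ae) (setIidPr Af) ef.
Qed.

Lemma leq_bin_exp r : 'C(n, r) <= n ^ r.
Proof.
apply: leq_trans (leq_pmulr _ (fact_gt0 r)) _; rewrite bin_ffact.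
by elim: r => [//|r IH]; rewrite ffactnSr expnSr leq_mul // leq_subr.
Qed.

Lemma card_touching S : #|touching S| <= #|S| * 'C(n, d).
Proof.
have sub : touching S \subset \bigcup_(x in S)
    [set e : {set 'I_n} | [set x] \subset e & #|e| == d + #|[set x]|].
  apply/subsetP => e; rewrite !inE => /andP[ce /exists_inP[x xe xS]].
  by apply/bigcupP; exists x; rewrite // inE sub1set xe cards1 addn1.
apply: leq_trans (subset_leq_card sub) _.
apply: leq_trans (leq_card_bigcup _ _) _.
by rewrite -sum_nat_const; apply: leq_sum => x _; apply: card_containing.
Qed.

Lemma card_touching2 S T : 0 < d -> [disjoint S & T] ->
  #|touching S :&: touching T| <= #|S| * #|T| * n ^ d.-1.
Proof.
move=> d0 ST.
have sub : touching S :&: touching T \subset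
    \bigcup_(u in setX S T) [set e : {set 'I_n} |
      [set u.1; u.2] \subset e & #|e| == d.-1 + #|[set u.1; u.2]|].
  apply/subsetP => e; rewrite !inE.
  move=> /andP[/andP[ce /exists_inP[x xe xS]] /andP[_ /exists_inP[y ye yT]]].
  apply/bigcupP; exists (x, y); rewrite !inE ?xS //= subUset !sub1set xe ye.
  have xy : x != y by apply: contraTneq yT => <-; rewrite (disjointFr ST xS).
  by rewrite cards2 xy addn2 prednK.
apply: leq_trans (subset_leq_card sub) _.
apply: leq_trans (leq_card_bigcup _ _) _.
rewrite -cardsX -sum_nat_const; apply: leq_sum => u _.
exact: leq_trans (card_containing _ _) (leq_bin_exp _).
Qed.

End EdgeCounts.

(** * First moment bounds *)
Section RandomHypergraph.
Import mathcomp.boot.fintype mathcomp.boot.finset.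
Variables (R : realType) (d n : nat).
Implicit Types (H F : {set {set 'I_n}}) (S T C e : {set 'I_n}).
Implicit Types (A B : {set {set 'I_n}} -> Prop) (q : R).
Local Notation E := (potential_edges d n).

(** Giving probability 0 to the sets that are not potential edges makes the
    random hypergraph a random subset of the type of all vertex sets. *)
Definition edge_law q e : R := if e \in E then q else 0.

Lemma edge_law_probs q : 0 <= q <= 1 -> probs (edge_law q).
Proof. by move=> q01 e; rewrite /edge_law; case: ifP; rewrite ?lexx ?ler01. Qed.

Lemma weight_out q H : ~~ (H \subset E) -> weight (edge_law q) H = 0.
Proof.
move=> /subsetPn[e eH eE].
by rewrite /weight (bigD1 e) //= eH /edge_law (negbTE eE) mul0r.
Qed.

Lemma PrE q A : Pr d q A = product_prob (edge_law q) A.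
Proof.
rewrite /Pr /product_prob big_mkcond [RHS]big_mkcond /=; apply: eq_bigr => H _.
rewrite powersetE; have [HE|HE] /= := boolP (H \subset E); last first.
  by rewrite weight_out // if_same.
case: ifP => // _; rewrite /weight big_mkcond /=; apply: eq_bigr => e _.
rewrite /edge_law; have [//|eE] := boolP (e \in E).
by rewrite subr0; case: ifP => // /(subsetP HE); rewrite (negbTE eE).
Qed.

Lemma product_prob_mono q A B : 0 <= q <= 1 -> (forall H, H \subset E -> A H -> B H) ->
  product_prob (edge_law q) A <= product_prob (edge_law q) B.
Proof.
move=> q01 AB; rewrite !product_probE; apply: ler_sum => H _.
have [HE|/weight_out->] := boolP (H \subset E); last by rewrite !mul0r.
rewrite ler_wpM2l ?weight_ge0 //; first exact: edge_law_probs.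
case: asboolP => [/(AB _ HE) h|_]; last exact: ler0n.
by rewrite asboolT.
Qed.

Lemma Pr_ge0 q A : 0 <= q <= 1 -> 0 <= Pr d q A.
Proof. by move=> q01; rewrite PrE product_prob_ge0 //; apply: edge_law_probs. Qed.

Lemma prod_edge_law q F : F \subset E ->
  \prod_(e in F) edge_law q e = q ^+ #|F|.
Proof.
move=> /subsetP FE; rewrite -prodr_const; apply: eq_bigr => e /FE eE.
by rewrite /edge_law eE.
Qed.

Lemma prod_1_edge_law q F : F \subset E ->
  \prod_(e in F) (1 - edge_law q e) = (1 - q) ^+ #|F|.
Proof.
move=> /subsetP FE; rewrite -prodr_const; apply: eq_bigr => e /FE eE.
by rewrite /edge_law eE.
Qed.

Lemma crossing_sub S : crossing d S \subset E.
Proof. by apply/subsetP => e; rewrite inE => /andP[]. Qed.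

Lemma touching_sub S : touching d S \subset E.
Proof. by apply/subsetP => e; rewrite inE => /andP[]. Qed.

Lemma prob_closed_with q S F : (0 < d)%N -> 0 <= q <= 1 -> F \subset E ->
  {in F, forall e : {set 'I_n}, e \subset S} ->
  product_prob (edge_law q) (fun H => edge_closed H S /\ F \subset H) <=
    q ^+ #|F| * (1 - q) ^+ (#|S| * 'C(n - #|S|, d)).
Proof.
move=> d0 q01 FE FS; have /andP[q0 q1] := q01.
apply: (@le_trans _ _ (product_prob (edge_law q)
          (fun H => F \subset H /\ [disjoint H & crossing d S]))).
  by apply: product_prob_mono => // H HE [/(edge_closed_crossing S HE)].
rewrite product_prob_cylinder; last first.
  rewrite disjoint_subset; apply/subsetP => e eF.
  by rewrite !inE FS // !andbF.
rewrite prod_edge_law // prod_1_edge_law ?crossing_sub //.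
rewrite ler_wpM2l ?exprn_ge0 //; apply: ler_wiXn2l; rewrite ?subr_ge0 //.
  by rewrite lerBlDr lerDl.
exact: card_crossing.
Qed.

Lemma prob_closed_set q delta (P : {set 'I_n} -> Prop) :
  (0 < d)%N -> 0 <= q <= 1 -> 0 <= delta ->
  (forall S, P S -> (1 - q) ^+ (#|S| * 'C(n - #|S|, d)) <= delta) ->
  Pr d q (fun H => exists2 S, edge_closed H S & P S) <= 2 ^+ n * delta.
Proof.
move=> d0 q01 de0 hP; have ep := edge_law_probs q01.
rewrite PrE; apply: (@le_trans _ _ (\sum_(S : {set 'I_n} | `[< P S >])
   product_prob (edge_law q) (fun H => edge_closed H S))).
  by apply: product_prob_union ep _ => H [S cl PS]; exists S => //; apply/asboolP.
apply: (@le_trans _ _ (\sum_(S : {set 'I_n} | `[< P S >]) delta)).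
  apply: ler_sum => S /asboolP /hP; apply: le_trans.
  have := @prob_closed_with q S finset.set0 d0 q01 (sub0set _).
  rewrite cards0 expr0 mul1r => h; apply: le_trans (h _); last by move=> e; rewrite inE.
  by apply: product_prob_mono => // H _ cl; split=> //; apply: sub0set.
rewrite big_mkcond /=; apply: (@le_trans _ _ (\sum_(S : {set 'I_n}) delta)).
  by apply: ler_sum => S _; case: ifP.
rewrite sumr_const -cardsT -powersetT card_powerset cardsT card_ord.
by rewrite -[leLHS]mulr_natl natrX.
Qed.

(** Halving the edge probability keeps a given component of size s with
    conditional probability at least (1/2)^(s-1), the cost of one spanning set
    of edges, whereas it makes the absence of its boundary edges much more
    likely. *)
Lemma prob_component_halve q S : (0 < d)%N -> 0 <= q <= 1 ->
  product_prob (edge_law q) (fun H => H \subset E /\ S \in components H) <=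
   2 ^+ #|S| * (1 - q / 2) ^+ (#|S| * 'C(n - #|S|, d)) *
   product_prob (edge_law (q / 2)) (fun H => H \subset E /\ S \in components H).
Proof.
move=> d0 q01; have /andP[q0 q1] := q01; set A := fun H => _.
(* No edge leaves the component S, so nothing is lost by giving the crossing
   edges the law q / 2 from the start and thinning only the other ones. *)
pose r e : R := if e \in crossing d S then 1 else 2^-1.
pose v e : R := if e \in crossing d S then edge_law (q / 2) e else edge_law q e.
have q2 : 0 <= q / 2 <= 1 by lra.
have [h0 h1] : 0 < 1 - q / 2 /\ 1 - q / 2 <= 1 by split; lra.
have half i : (1 - q) ^+ i <= (1 - q / 2) ^+ i * (1 - q / 2) ^+ i.
  have qq : 0 <= q * q / 4 by rewrite divr_ge0 ?mulr_ge0.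
  rewrite -exprMn; have -> : (1 - q / 2) * (1 - q / 2) = 1 - q + q * q / 4 by field.
  by apply: lerXn2r; rewrite ?nnegrE; lra.
have r01 : probs r by move=> e; rewrite /r; case: ifP => _; lra.
have v01 : probs v by move=> e; rewrite /v; case: ifP => _; apply: edge_law_probs.
have vr : (fun e => v e * r e) = edge_law (q / 2).
  apply/funext => e; rewrite /v /r /edge_law; case: ifP; rewrite ?mulr1 //.
  by case: ifP; rewrite ?mul0r.
have thin : 2^-1 ^+ #|S| * product_prob v A <= product_prob (edge_law (q / 2)) A.
  rewrite -vr; apply: thinning => // K [KE Sc].
  have [M [MK cM conv]] := component_witness (potential_uniform KE) Sc.
  exists M; split=> // [|J MJ JK]; last first.
    by split; [apply: fintype.subset_trans JK KE|apply: conv].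
  apply: (@le_trans _ _ (\prod_(e in M) 2^-1)); last first.
    by apply: ler_prod => e _; rewrite /r; case: ifP => _; lra.
  rewrite prodr_const; apply: ler_wiXn2l; [lra|lra|exact: ltnW].
set c := #|crossing d S|.
have swap : (1 - q) ^+ c * product_prob v A = (1 - q / 2) ^+ c * product_prob (edge_law q) A.
  rewrite /product_prob !mulr_sumr; apply: eq_bigr => K /asboolP[KE Sc].
  have dis : [disjoint K & crossing d S].
    by apply/(edge_closed_crossing S KE); apply: component_edge_closed.
  rewrite /c -!prodr_const /weight (big_mkcond (mem (crossing d S))) -big_split /=.
  rewrite [in RHS](big_mkcond (mem (crossing d S))) -big_split /=.
  apply: eq_bigr => e _; rewrite /v; case: ifP => [ec|_]; last by rewrite !mul1r.
  rewrite (disjointFl dis ec) /edge_law (subsetP (crossing_sub S) _ ec); ring.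
have pos : 0 < (1 - q / 2) ^+ c by apply: exprn_gt0.
rewrite -(ler_pM2l pos) -swap.
have b0 := product_prob_ge0 A v01; have b1 := product_prob_ge0 A (edge_law_probs q2).
apply: le_trans (ler_wpM2r b0 (half c)) _; rewrite -!mulrA ler_pM2l //.
have le_c : (1 - q / 2) ^+ c <= (1 - q / 2) ^+ (#|S| * 'C(n - #|S|, d)).
  by apply: ler_wiXn2l (ltW h0) h1 _ _ _; exact: card_crossing.
apply: (@le_trans _ _ ((1 - q / 2) ^+ c * (2 ^+ #|S| * product_prob (edge_law (q / 2)) A))).
  rewrite ler_pM2l // -ler_pdivrMl ?exprn_gt0 // ?ltr0n //.
  by rewrite -exprVn.
rewrite [leLHS]mulrCA; apply: ler_wpM2l; first exact: exprn_ge0.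
exact: ler_wpM2r.
Qed.

(** Compared with q / 2, each event costs at most a factor delta, and the
    expected number of components at q / 2 is at most n. *)
Lemma prob_component q delta (P : {set 'I_n} -> Prop) :
  (0 < d)%N -> 0 <= q <= 1 -> 0 <= delta ->
  (forall S, P S -> 2 ^+ #|S| * (1 - q / 2) ^+ (#|S| * 'C(n - #|S|, d)) <= delta) ->
  Pr d q (fun H => exists2 S, S \in components H & P S) <= n%:R * delta.
Proof.
move=> d0 q01 de0 hP; have ep := edge_law_probs q01.
have q2 : 0 <= q / 2 <= 1 by lra.
pose A S H := H \subset E /\ S \in components H.
rewrite PrE; apply: (@le_trans _ _ (\sum_(S : {set 'I_n} | `[< P S >])
   product_prob (edge_law q) (A S))).
  apply: le_trans (product_prob_union ep (A := fun H =>
    H \subset E /\ exists2 S, S \in components H & P S) _).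
    by apply: product_prob_mono.
  by move=> H [HE [S cl PS]]; exists S => //; apply/asboolP.
apply: (@le_trans _ _ (\sum_(S : {set 'I_n}) delta * product_prob (edge_law (q / 2)) (A S))).
  rewrite big_mkcond /=; apply: ler_sum => S _.
  have b0 := product_prob_ge0 (A S) (edge_law_probs q2).
  case: asboolP => [/hP PS|_]; last exact: mulr_ge0.
  by apply: le_trans (prob_component_halve S d0 q01) _; apply: ler_wpM2r.
rewrite -mulr_sumr mulrC ler_wpM2r //.
under eq_bigr do rewrite product_probE.
rewrite exchange_big /=.
have -> : n%:R = \sum_(H : {set {set 'I_n}}) weight (edge_law (q / 2)) H * n%:R :> R.
  by rewrite -mulr_suml sum_weight mul1r.
apply: ler_sum => H _; rewrite -mulr_sumr ler_wpM2l ?weight_ge0 //.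
  exact: edge_law_probs.
apply: (@le_trans _ _ #|components H|%:R).
  rewrite -sum1_card natr_sum [leRHS]big_mkcond; apply: ler_sum => S _.
  case: asboolP => [[_ ->]|_] //; case: ifP => // _; exact: ler01.
rewrite ler_nat -[leqRHS](card_ord n) -cardsT.
apply: leq_trans (leq_imset_card _ _) _.
by apply: subset_leq_card; apply/subsetP => x; rewrite inE.
Qed.

Lemma prob_small_closed q s t : (0 < d)%N -> 0 <= q <= 1 ->
  Pr d q (fun H => exists S, [/\ edge_closed H S, #|S| = s & #|edges_in H S| = t]) <=
   n%:R ^+ s * 2 ^+ (2 ^ s) * (q ^+ t * (1 - q) ^+ (s * 'C(n - s, d))).
Proof.
move=> d0 q01; have /andP[q0 q1] := q01; have ep := edge_law_probs q01.
set X := q ^+ t * _.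
have X0 : 0 <= X by rewrite mulr_ge0 ?exprn_ge0 // subr_ge0.
pose P S := #|S| == s.
pose Q S F := [&& F \in powerset (powerset S), F \subset E & #|F| == t].
rewrite PrE; apply: (@le_trans _ _ (\sum_(S : {set 'I_n} | P S)
   product_prob (edge_law q) (fun H => exists2 F, Q S F & edge_closed H S /\ F \subset H))).
  apply: le_trans (product_prob_union ep (A := fun H => H \subset E /\
    exists S, [/\ edge_closed H S, #|S| = s & #|edges_in H S| = t]) _).
    by apply: product_prob_mono.
  move=> H [HE [S [cl cS cF]]]; exists S; first by rewrite /P cS.
  have FH : edges_in H S \subset H by apply/subsetP => e; rewrite inE => /andP[].
  exists (edges_in H S) => //; rewrite /Q cF eqxx andbT (fintype.subset_trans FH HE) andbT.
  by rewrite powersetE; apply/subsetP => e; rewrite inE powersetE => /andP[].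
apply: (@le_trans _ _ (\sum_(S : {set 'I_n} | P S) 2 ^+ (2 ^ s) * X)); last first.
  rewrite sumr_const -mulrA -[leLHS]mulr_natl; apply: ler_wpM2r.
    by apply: mulr_ge0 X0; apply: exprn_ge0.
  rewrite (_ : #|_| = 'C(n, s)); last first.
    by rewrite -[in RHS](card_ord n) -card_draws; apply: eq_card => S; rewrite !inE.
  by rewrite -natrX ler_nat leq_bin_exp.
apply: ler_sum => S /eqP cS.
apply: (@le_trans _ _ (\sum_(F : {set {set 'I_n}} | Q S F) X)); last first.
  rewrite sumr_const -[leLHS]mulr_natl ler_wpM2r // -natrX ler_nat.
  apply: (@leq_trans #|powerset (powerset S)|); last by rewrite !card_powerset cS.
  by apply: subset_leq_card; apply/subsetP => F /and3P[].
apply: (@le_trans _ _ (\sum_(F : {set {set 'I_n}} | Q S F)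
    product_prob (edge_law q) (fun H => edge_closed H S /\ F \subset H))).
  by apply: product_prob_union ep _ => H [F QF h]; exists F.
apply: ler_sum => F /and3P[FS FE /eqP cF].
have := @prob_closed_with q S F d0 q01 FE; rewrite cF cS; apply=> e eF.
by move: FS; rewrite powersetE => /subsetP /(_ e eF); rewrite powersetE.
Qed.

End RandomHypergraph.

(** * Second moment bound for the copies of a butterfly *)
Section ButterflyCopies.
Import mathcomp.boot.fintype mathcomp.boot.finset.
Variables (R : realType) (d n : nat).
Implicit Types (H F : {set {set 'I_n}}) (S T C e : {set 'I_n}).
Local Notation E := (potential_edges d n).

(** Here nu bounds the mean from below.  The factor 1 + eps accounts for the
    potential edges that meet two disjoint m-sets: they are counted twice in
    the product of the two probabilities, but there are at most
    m^2 n^(d-1) of them. *)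
Lemma prob_few_copies (q eps : R) (m k : nat) (B : hypergraph 'I_m)
   (nu := 'C(n, m)%:R * (q ^+ #|B| * (1 - q) ^+ (m * 'C(n, d)))) :
  (0 < d)%N -> 0 <= q <= 1 -> 0 <= eps -> butterfly d B ->
  1 <= (1 + eps) * (1 - q) ^+ (m * m * n ^ d.-1) ->
  0 < nu -> 2 * k%:R <= nu ->
  Pr d q (fun H =>
      (#|[set C in components H | `[< isomorphic B (sub_hypergraph H C) >]]| < k)%N)
    <= 4 / nu + 4 * eps.
Proof.
move=> d0 q01 eps0 [conB _ uB] heps nu0 knu; have /andP[q0 q1] := q01.
have ep : probs (@edge_law R d n q) by exact: edge_law_probs.
have [m0 _] := conB; rewrite card_ord in m0.
have /choice[G hG] : forall S : {set 'I_n}, exists G : {set {set 'I_n}}, #|S| = m ->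
   [/\ #|G| = #|B|,
    {in G, forall e : {set 'I_n}, e \subset S /\ #|e| = d.+1} &
    forall H, uniform d.+1 H -> G \subset H ->
      (forall e x, e \in H -> x \in e -> x \in S -> e \in G) ->
      S \in components H /\ isomorphic B (sub_hypergraph H S)].
  move=> S; have [cS|nS] := pselect (#|S| = m); last by exists finset.set0.
  by have [G hG] := butterfly_copy conB uB cS; exists G.
pose D S := touching d S :\: G S.
pose A S H := G S \subset H /\ [disjoint H & D S].
pose P S := #|S| == m.
have GD S : [disjoint G S & D S].
  by rewrite disjoint_subset; apply/subsetP => e eG; rewrite !inE eG.
have GE S : P S -> G S \subset E.
  move=> /eqP /hG[_ h _]; apply/subsetP => e /h[_ ce]; by rewrite inE ce.
have DE S : D S \subset E.
  by apply: fintype.subset_trans (subsetDl _ _) (touching_sub _ _).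
have A_comp S H : P S -> H \subset E -> A S H ->
    S \in components H /\ isomorphic B (sub_hypergraph H S).
  move=> /eqP /hG[_ _ h] HE [GH HD]; apply: h => //; first exact: potential_uniform.
  move=> e x eH xe xS; apply: contraT => eG; have := disjointFr HD eH.
  rewrite !inE eG /=; have := subsetP HE _ eH; rewrite inE => -> /=.
  by move=> /existsP; case; exists x; rewrite xe.
have AE S : P S -> product_prob (@edge_law R d n q) (A S) = q ^+ #|B| * (1 - q) ^+ #|D S|.
  move=> PS; rewrite product_prob_cylinder // prod_edge_law ?GE // prod_1_edge_law //.
  by have [-> _ _] := hG S (eqP PS).
set mu := \sum_(S | P S) product_prob (@edge_law R d n q) (A S).
have numu : nu <= mu.
  have -> : nu = \sum_(S | P S) q ^+ #|B| * (1 - q) ^+ (m * 'C(n, d)).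
    rewrite sumr_const -[RHS]mulr_natl; congr (_%:R * _).
    by rewrite -[in LHS](card_ord n) -card_draws; apply: eq_card => S; rewrite !inE.
  apply: ler_sum => S PS; rewrite AE // ler_wpM2l ?exprn_ge0 //.
  apply: ler_wiXn2l; rewrite ?subr_ge0 // ?lerBlDr ?lerDl //.
  apply: leq_trans (subset_leq_card (subsetDl _ _)) _.
  by rewrite -(eqP PS); apply: card_touching.
have mu0 : 0 < mu by apply: lt_le_trans numu.
have cor S T : P S -> P T -> S != T ->
    product_prob (@edge_law R d n q) (fun H => A S H /\ A T H) <=
    (1 + eps) * (product_prob (@edge_law R d n q) (A S) * product_prob (@edge_law R d n q) (A T)).
  move=> PS PT ST; have [dis|ndis] := boolP [disjoint S & T]; last first.
    apply: (@le_trans _ _ 0); last by rewrite !mulr_ge0 ?product_prob_ge0 ?addr_ge0.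
    apply: (@le_trans _ _ (product_prob (@edge_law R d n q) (fun H => False))); last first.
      by rewrite /product_prob big_pred0 // => H; apply/asboolP.
    apply: product_prob_mono => // H HE [/(A_comp _ _ PS HE)[Sc _] /(A_comp _ _ PT HE)[Tc _]].
    move: ndis; rewrite disjoint_subset => /subsetPn[x xS].
    by rewrite !inE negbK => xT; rewrite (component_eq Sc Tc xS xT) eqxx in ST.
  rewrite !AE //.
  have GDx S' T' : P S' -> P T' -> [disjoint S' & T'] -> [disjoint G S' & D T'].
    move=> PS' PT' dis'; rewrite disjoint_subset; apply/subsetP => e eG.
    have [_ /(_ e eG)[eS _] _] := hG S' (eqP PS').
    rewrite !inE; apply/negP => /andP[_ /andP[_ /exists_inP[x xe xT]]].
    by rewrite (disjointFr dis' (subsetP eS _ xe)) in xT.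
  have dis2 : [disjoint T & S] by rewrite disjoint_sym.
  have dGG : [disjoint G S & G T].
    rewrite disjoint_subset; apply/subsetP => e eG; rewrite inE; apply/negP => eG'.
    have [_ /(_ e eG)[eS ce] _] := hG S (eqP PS).
    have [_ /(_ e eG')[eT _] _] := hG T (eqP PT).
    have /card_gt0P[x xe] : (0 < #|e|)%N by rewrite ce.
    by have := disjointFr dis (subsetP eS _ xe); rewrite (subsetP eT).
  have -> : product_prob (@edge_law R d n q) (fun H => A S H /\ A T H) =
     q ^+ #|G S :|: G T| * (1 - q) ^+ #|D S :|: D T|.
    transitivity (product_prob (@edge_law R d n q) (fun H => G S :|: G T \subset H /\
       [disjoint H & D S :|: D T])).
      congr product_prob; apply/funext => H; apply/propext.
      rewrite /A subUset -!setI_eq0 setIUr setU_eq0.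
      by split=> [[[-> ->] [-> ->]]|[/andP[-> ->] /andP[-> ->]]].
    rewrite product_prob_cylinder ?prod_edge_law ?prod_1_edge_law //.
    - by rewrite subUset !DE.
    - by rewrite subUset !GE.
    - by rewrite -setI_eq0 setIUl !setIUr !setU_eq0 !setI_eq0 !GD !GDx.
  have -> : #|G S :|: G T| = (#|B| + #|B|)%N.
    have [cS _ _] := hG S (eqP PS); have [cT _ _] := hG T (eqP PT).
    by have := cardsUI (G S) (G T); rewrite (disjoint_setI0 dGG) cards0 addn0 cS cT.
  set u := #|D S :|: D T|; set N := #|D S :&: D T|.
  have DN : (#|D S| + #|D T| = u + N)%N by rewrite -cardsUI.
  have leN : (N <= m * m * n ^ d.-1)%N.
    have := card_touching2 d0 dis; rewrite (eqP PS) (eqP PT); apply: leq_trans.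
    by apply: subset_leq_card; apply: setISS; apply: subsetDl.
  have one : 1 <= (1 + eps) * (1 - q) ^+ N.
    apply: le_trans heps _; rewrite ler_wpM2l ?addr_ge0 //.
    by apply: ler_wiXn2l leN; rewrite ?subr_ge0 // lerBlDr lerDl.
  have -> : (1 + eps) * (q ^+ #|B| * (1 - q) ^+ #|D S| * (q ^+ #|B| * (1 - q) ^+ #|D T|))
     = (1 + eps) * (1 - q) ^+ N * (q ^+ (#|B| + #|B|) * (1 - q) ^+ u).
    rewrite mulrACA -!exprD DN [(1 - q) ^+ (u + N)]exprD -!mulrA.
    by congr (_ * _); rewrite [RHS]mulrCA; congr (_ * _); rewrite mulrC.
  by apply: ler_peMl one; rewrite mulr_ge0 ?exprn_ge0 ?subr_ge0.
rewrite PrE; apply: (@le_trans _ _ (4 / mu + 4 * eps)); last first.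
  by rewrite lerD2r ler_pM2l // lef_pV2 ?posrE.
apply: le_trans _ (second_moment ep eps0 cor mu0 (le_trans knu numu)).
apply: product_prob_mono => // H HE; apply: leq_ltn_trans; apply: subset_leq_card.
apply/subsetP => S; rewrite inE => /andP[PS /asboolP /(A_comp _ _ PS HE)[Sc iso]].
by rewrite inE Sc /=; apply/asboolP.
Qed.

End ButterflyCopies.

(** * Elementary inequalities *)
Section RealEstimates.
Variable R : realType.
Implicit Types (x y q : R).

Lemma sqr_le_expR (A : R) x : 1 <= x -> 6 * A <= x -> A * x ^+ 2 <= expR x.
Proof.
move=> x1 Ax; have x0 : 0 <= x by lra.
have := expR_ge1Dxn 2 x0; apply: le_trans.
apply: (@le_trans _ _ (x ^+ 3 / (3`!)%:R)); last by rewrite lerDr.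
rewrite ler_pdivlMr ?ltr0n // (_ : (3`!)%:R = 6) //.
by rewrite mulrAC [A * _]mulrC [x ^+ 3]exprS ler_wpM2r ?exprn_ge0.
Qed.

Lemma pow_le_expR q k : 0 <= q <= 1 -> (1 - q) ^+ k <= expR (- (q * k%:R)).
Proof.
move=> /andP[q0 q1]; rewrite -mulNr expRM_natr; apply: lerXn2r.
- by rewrite nnegrE subr_ge0.
- by rewrite nnegrE expR_ge0.
- exact: expR_ge1Dx.
Qed.

(** A lower bound matching pow_le_expR up to second order; it comes from
    1 / (1 - q) = 1 + q / (1 - q) <= exp (q / (1 - q)). *)
Lemma pow_ge_expR q k : 0 <= q <= 2^-1 ->
  expR (- (q * k%:R) - 2 * (q ^+ 2 * k%:R)) <= (1 - q) ^+ k.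
Proof.
move=> /andP[q0 q1].
have -> : - (q * k%:R) - 2 * (q ^+ 2 * k%:R) = - (q + 2 * q ^+ 2) * k%:R by ring.
rewrite expRM_natr; apply: lerXn2r; rewrite ?nnegrE ?expR_ge0 //; first by lra.
have q2 : 0 < 1 - q by lra.
rewrite expRN -[leRHS]invrK lef_pV2 ?posrE ?invr_gt0 ?expR_gt0 //.
apply: le_trans (expR_ge1Dx _); rewrite -[leLHS]mul1r ler_pdivrMr //.
rewrite -subr_ge0.
have -> : (1 + (q + 2 * q ^+ 2)) * (1 - q) - 1 = q ^+ 2 * (1 - 2 * q) by ring.
by rewrite mulr_ge0 ?exprn_ge0 //; lra.
Qed.

Lemma bernoulli x k : 0 <= x <= 1 -> 1 - k%:R * x <= (1 - x) ^+ k.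
Proof.
move=> /andP[x0 x1]; elim: k => [|k IH]; first by rewrite mul0r subr0.
rewrite exprS; apply: (@le_trans _ _ ((1 - x) * (1 - k%:R * x))); last first.
  by rewrite ler_wpM2l // subr_ge0.
rewrite -natr1 -subr_ge0.
have -> : (1 - x) * (1 - k%:R * x) - (1 - (k%:R + 1) * x) = k%:R * x ^+ 2 by ring.
by rewrite mulr_ge0 ?exprn_ge0.
Qed.

Lemma expr_le_ffact m r : ((m - r) ^ r <= m ^_ r)%N.
Proof.
elim: r m => [|r IH] m //; rewrite ffactnS expnS subnS -subn1 subnAC subn1.
apply: leq_mul; last exact: IH.
by apply: leq_trans (leq_subr _ _) (leq_pred _).
Qed.

Lemma expR_small (C eps : R) : 0 < eps ->
  exists A, forall x, x <= - A -> C * expR x <= eps.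
Proof.
move=> eps0; exists (`|C| / eps) => x xA.
have h : C * expR x <= `|C| * expR (- (`|C| / eps)).
  apply: (@le_trans _ _ (`|C| * expR x)).
    by rewrite ler_wpM2r ?expR_ge0 // ler_norm.
  by rewrite ler_wpM2l // ler_expR.
apply: le_trans h _; rewrite expRN ler_pdivrMr ?expR_gt0 // mulrC -ler_pdivrMr //.
by apply: le_trans (expR_ge1Dx _); rewrite lerDr.
Qed.

End RealEstimates.

(** * Asymptotics at the threshold *)
Section Asymptotics.
Local Open Scope classical_set_scope.
Variables (R : realType) (d l : nat) (p : nat -> R).
Hypothesis hd : (1 <= d)%N.
Hypothesis hp : forall n, 0 <= p n <= 1.
Hypothesis hl : c_ d l p n @[n --> \oo] --> -oo%R.
Hypothesis hl1 : c_ d l.+1 p n @[n --> \oo] --> +oo%R.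

Let L n : R := ln n%:R.
Let M n : R := ln (L n).

Definition mean_degree n : R := n%:R ^+ d * p n / d`!%:R.
Local Notation lam := mean_degree.
Local Notation B := (1 + l.+1 * d)%N.

Lemma c_E j n : c_ d j p n = (1 + j * d)%:R * lam n - L n - j%:R * M n.
Proof. by rewrite /c_ /lam; congr (_ - _ - _); rewrite -!mulrA; ring. Qed.

Lemma lam_ge0 n : 0 <= lam n.
Proof. by have /andP[h _] := hp n; rewrite /lam !mulr_ge0 ?exprn_ge0 ?invr_ge0. Qed.

Lemma near_ln A : \forall n \near \oo, A <= L n.
Proof.
near=> n; have h : expR A <= n%:R by near: n; exact: nbhs_infty_ger.
have n0 : 0 < n%:R :> R by apply: lt_le_trans h; apply: expR_gt0.
by rewrite -ler_expR lnK.
Unshelve. all: by end_near. Qed.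

Lemma near_lnln A : \forall n \near \oo, A <= M n.
Proof.
near=> n; have h : expR A <= L n by near: n; exact: near_ln.
have n0 : 0 < L n by apply: lt_le_trans h; apply: expR_gt0.
by rewrite -ler_expR lnK.
Unshelve. all: by end_near. Qed.

Lemma near_expR_ln : \forall n \near \oo, expR (L n) = n%:R.
Proof.
near=> n; rewrite lnK // posrE ltr0n; near: n; exact: nbhs_infty_gt.
Unshelve. all: by end_near. Qed.

Lemma near_expR_lnln : \forall n \near \oo, expR (M n) = L n.
Proof.
near=> n; have h : 1 <= L n by near: n; exact: near_ln.
by rewrite lnK // posrE; lra.
Unshelve. all: by end_near. Qed.

Lemma near_ln_sqr A : \forall n \near \oo, A * L n ^+ 2 <= n%:R.
Proof.
near=> n; have <- : expR (L n) = n%:R by near: n; exact: near_expR_ln.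
by apply: sqr_le_expR; near: n; exact: near_ln.
Unshelve. all: by end_near. Qed.

Lemma near_lnln_sqr A : \forall n \near \oo, A * M n ^+ 2 <= L n.
Proof.
near=> n; have <- : expR (M n) = L n by near: n; exact: near_expR_lnln.
by apply: sqr_le_expR; near: n; exact: near_lnln.
Unshelve. all: by end_near. Qed.

Lemma near_ln_lin A : \forall n \near \oo, A * L n <= n%:R.
Proof.
near=> n; have h1 : 1 <= L n by near: n; exact: near_ln.
have h2 : `|A| * L n ^+ 2 <= n%:R by near: n; exact: near_ln_sqr.
apply: le_trans h2; apply: le_trans (_ : `|A| * L n <= _).
  by rewrite ler_wpM2r ?ler_norm //; lra.
by rewrite ler_wpM2l // expr2 ler_peMl //; lra.
Unshelve. all: by end_near. Qed.

Lemma near_lnln_lin A : \forall n \near \oo, A * M n <= L n.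
Proof.
near=> n; have h1 : 1 <= M n by near: n; exact: near_lnln.
have h2 : `|A| * M n ^+ 2 <= L n by near: n; exact: near_lnln_sqr.
apply: le_trans h2; apply: le_trans (_ : `|A| * M n <= _).
  by rewrite ler_wpM2r ?ler_norm //; lra.
by rewrite ler_wpM2l // expr2 ler_peMl //; lra.
Unshelve. all: by end_near. Qed.

Lemma near_lam_ge A : \forall n \near \oo, L n + l.+1%:R * M n + A <= B%:R * lam n.
Proof.
near=> n; have : A <= c_ d l.+1 p n by near: n; move/cvgryPge : hl1; apply.
by rewrite c_E; lra.
Unshelve. all: by end_near. Qed.

Lemma near_lam_ge_ln : \forall n \near \oo, L n <= B%:R * lam n.
Proof.
near=> n; have h : L n + l.+1%:R * M n + 0 <= B%:R * lam n.
  by near: n; exact: near_lam_ge.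
have M0 : 0 <= M n by near: n; exact: near_lnln.
apply: le_trans h; rewrite addr0 lerDl mulr_ge0 //.
Unshelve. all: by end_near. Qed.

Lemma near_lam_infty A : \forall n \near \oo, A <= lam n.
Proof.
near=> n; have h : L n <= B%:R * lam n by near: n; exact: near_lam_ge_ln.
have : B%:R * A <= L n by near: n; exact: near_ln.
by move=> h2; rewrite -(ler_pM2l (_ : 0 < B%:R)) ?ltr0n // (le_trans h2).
Unshelve. all: by end_near. Qed.

Lemma near_lam_le : \forall n \near \oo, lam n <= 2 * L n.
Proof.
near=> n; have : c_ d l p n <= 0 by near: n; move/cvgrNyPle : hl; apply.
have h : l%:R * M n <= L n by near: n; exact: near_lnln_lin.
have h0 := lam_ge0 n; rewrite c_E => h1.
have : lam n <= (1 + l * d)%:R * lam n by rewrite ler_peMl // ler1n.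
lra.
Unshelve. all: by end_near. Qed.

(** For j < l the upper bound on lam given by c_l leaves the term - L / (1 + l d)
    in c_j, which dominates the multiples of M. *)
Lemma c_cvgNy j : (j <= l)%N -> c_ d j p n @[n --> \oo] --> -oo%R.
Proof.
move=> jl; move: (jl); rewrite leq_eqVlt => /orP[/eqP->//|jltl].
apply/cvgrNyPle => A; near=> n; rewrite c_E.
have h : c_ d l p n <= 0 by near: n; move/cvgrNyPle : hl; apply.
rewrite c_E in h.
have M0 : 0 <= M n by near: n; exact: near_lnln.
have L0 : 0 <= L n by near: n; exact: near_ln.
set a := (1 + j * d)%:R in h *; set b := (1 + l * d)%:R in h *.
have LM : 2 * (a * l%:R) * M n <= L n by near: n; exact: near_lnln_lin.
have LA : 2 * (b * - A) <= L n by near: n; exact: near_ln.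
have ab : a + 1 <= b by rewrite natr1 ler_nat; nia.
have a0 : 0 <= a by [].
have b0 : 0 < b by rewrite ltr0n.
rewrite -(ler_pM2l b0) !mulrBr mulrCA.
have h1 : a * (b * lam n) <= a * (L n + l%:R * M n) by rewrite ler_wpM2l //; lra.
have h2 : (a + 1) * L n <= b * L n by rewrite ler_wpM2r.
have h3 : 0 <= b * (j%:R * M n) by rewrite !mulr_ge0 // ltW.
lra.
Unshelve. all: by end_near. Qed.

Lemma near_p_small (eps : R) : 0 < eps -> \forall n \near \oo, p n <= eps.
Proof.
move=> eps0; near=> n.
have h1 : lam n <= 2 * L n by near: n; exact: near_lam_le.
have h2 : 2 * d`!%:R / eps * L n <= n%:R by near: n; exact: near_ln_lin.
have n0 : 0 < n%:R :> R by rewrite ltr0n; near: n; exact: nbhs_infty_gt.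
have n1 : 1 <= n%:R :> R by rewrite ler1n -(ltr0n R).
have pE : lam n * d`!%:R = n%:R ^+ d * p n.
  by rewrite /lam divfK // pnatr_eq0 -lt0n fact_gt0.
have h3 : n%:R * p n <= lam n * d`!%:R.
  have /andP[p0 _] := hp n; rewrite pE ler_wpM2r //.
  by rewrite -(prednK hd) exprS ler_peMr // exprn_ege1.
rewrite -(ler_pM2l n0); apply: le_trans h3 _.
apply: le_trans (_ : 2 * L n * d`!%:R <= _); first by rewrite ler_wpM2r.
rewrite mulrC; apply: le_trans (_ : 2 * d`!%:R * L n <= _); first
  by rewrite mulrA [_ * 2]mulrC.
by rewrite -ler_pdivrMr // mulrAC.
Unshelve. all: by end_near. Qed.

Lemma lam_quarter n s : (2 * s <= n)%N -> (4 * d <= n)%N ->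
  lam n / 4 ^+ d <= p n * 'C(n - s, d)%:R.
Proof.
move=> sn dn; have /andP[p0 _] := hp n.
have f0 : 0 < d`!%:R :> R by rewrite ltr0n fact_gt0.
have h : (n ^ d <= 4 ^ d * ('C(n - s, d) * d`!))%N.
  rewrite bin_ffact; apply: leq_trans (leq_mul (leqnn _) (expr_le_ffact _ _)).
  by rewrite -expnMn leq_exp2r //; lia.
rewrite /lam ler_pdivrMr ?exprn_gt0 // ler_pdivrMr // [n%:R ^+ d * _]mulrC -!mulrA.
rewrite ler_wpM2l // -!natrX -!natrM ler_nat.
by apply: leq_trans h _; rewrite mulnC mulnAC mulnA.
Qed.

Lemma lam_fixed n s : (s + d <= n)%N -> (0 < n)%N ->
  lam n * (1 - d%:R * ((s + d)%:R / n%:R)) <= p n * 'C(n - s, d)%:R.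
Proof.
move=> sdn n0; have /andP[p0 _] := hp n.
have f0 : 0 < d`!%:R :> R by rewrite ltr0n fact_gt0.
have n0' : 0 < n%:R :> R by rewrite ltr0n.
set x : R := (s + d)%:R / n%:R.
have x01 : 0 <= x <= 1 by rewrite divr_ge0 //= ler_pdivrMr // mul1r ler_nat.
apply: le_trans (_ : lam n * (1 - x) ^+ d <= _).
  by rewrite ler_wpM2l ?lam_ge0 ?bernoulli.
rewrite /lam mulrAC ler_pdivrMr // mulrAC -exprMn.
rewrite mulrBr mulr1 /x mulrC [n%:R * _]mulrC divfK ?gt_eqF // -mulrA ler_wpM2l //.
rewrite -natrB // -natrX -natrM ler_nat bin_ffact subnDA.
exact: expr_le_ffact.
Qed.

Lemma near_lam_fixed s : \forall n \near \oo,
  lam n - 1 <= p n * 'C(n - s, d)%:R.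
Proof.
near=> n.
have n0 : (0 < n)%N by near: n; exact: nbhs_infty_gt.
have sdn : (s + d <= n)%N by near: n; exact: nbhs_infty_ge.
apply: le_trans (lam_fixed sdn n0).
have n0' : 0 < n%:R :> R by rewrite ltr0n.
rewrite mulrBr mulr1 lerD2l lerN2 !mulrA ler_pdivrMr // mul1r.
have h1 : lam n <= 2 * L n by near: n; exact: near_lam_le.
have h2 : d%:R * (s + d)%:R * 2 * L n <= n%:R by near: n; exact: near_ln_lin.
have h3 : d%:R * (s + d)%:R * lam n <= d%:R * (s + d)%:R * (2 * L n).
  by rewrite ler_wpM2l.
lra.
Unshelve. all: by end_near. Qed.

Definition negligible (A : forall n, hypergraph 'I_n -> Prop) :=
  forall eps : R, 0 < eps -> \forall n \near \oo, Pr d (p n) (A n) <= eps.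

Lemma Pr_mono n (A1 A2 : hypergraph 'I_n -> Prop) :
  (forall H : {set {set 'I_n}}, H \subset potential_edges d n -> A1 H -> A2 H) ->
  Pr d (p n) A1 <= Pr d (p n) A2.
Proof. by move=> h; rewrite !PrE; apply: product_prob_mono. Qed.

Lemma negligible_aas (A Bad : forall n, hypergraph 'I_n -> Prop) :
  (forall n (H : {set {set 'I_n}}), H \subset potential_edges d n ->
     ~ Bad n H -> A n H) ->
  negligible Bad -> aas d p A.
Proof.
move=> h neg; apply/cvgrPdist_le => eps eps0; near=> n.
have := product_probC (@edge_law R d n (p n)) (A n); rewrite -!PrE => tot.
have -> : 1 - Pr d (p n) (A n) = Pr d (p n) (fun H => ~ A n H) by rewrite -tot; ring.
rewrite ger0_norm ?Pr_ge0 //.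
apply: le_trans (_ : Pr d (p n) (Bad n) <= _); last by near: n; exact: neg.
apply: Pr_mono => H HE nA; apply: contrapT => nB; exact: nA (h _ _ HE nB).
Unshelve. all: by end_near. Qed.

Lemma negligible_exists (I : finType) (A : I -> forall n, hypergraph 'I_n -> Prop) :
  (forall i, negligible (A i)) -> negligible (fun n H => exists i, A i n H).
Proof.
move=> neg eps eps0; near=> n.
have h i : Pr d (p n) (A i n) <= eps / #|I|.+1%:R.
  move: i; near: n; apply: filter_forall => i; apply: neg.
  by rewrite divr_gt0 // ltr0n.
rewrite PrE; apply: le_trans (product_prob_union (P := predT) (B := fun i => A i n) _ _) _.
- exact: edge_law_probs.
- by move=> H [i Ai]; exists i.
apply: (@le_trans _ _ (\sum_(i : I) eps / #|I|.+1%:R)).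
  by apply: ler_sum => i _; rewrite -PrE.
rewrite sumr_const -[leLHS]mulr_natl mulrCA ger_pMr // ler_pdivrMr ?ltr0n // mul1r.
by rewrite ler_nat.
Unshelve. all: by end_near. Qed.

Lemma negligible_or (A1 A2 : forall n, hypergraph 'I_n -> Prop) :
  negligible A1 -> negligible A2 -> negligible (fun n H => A1 n H \/ A2 n H).
Proof.
move=> n1 n2 eps eps0.
have neg (b : bool) : negligible (if b then A1 else A2) by case: b.
have := negligible_exists neg eps0; apply: filterS => n; apply: le_trans.
by apply: Pr_mono => H _ [h1|h2]; [exists true|exists false].
Qed.

Lemma near_expR_le (eps : R) : 0 < eps -> \forall n \near \oo, expR (- L n) <= eps.
Proof.
move=> eps0; have [A hA] := expR_small 1 eps0; near=> n.
rewrite -[leLHS]mul1r; apply: hA; rewrite lerN2; near: n; exact: near_ln.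
Unshelve. all: by end_near. Qed.

Lemma near_expR_nat (eps : R) : 0 < eps -> \forall n \near \oo, expR (- n%:R) <= eps.
Proof.
move=> eps0; have [A hA] := expR_small 1 eps0; near=> n.
rewrite -[leLHS]mul1r; apply: hA; rewrite lerN2; near: n; exact: nbhs_infty_ger.
Unshelve. all: by end_near. Qed.

Lemma exp2_le n : 2 ^+ n <= expR n%:R :> R.
Proof.
rewrite -[n%:R]mul1r expRM_natr; apply: lerXn2r; rewrite ?nnegrE ?expR_ge0 //.
by have := expR_ge1Dx (1 : R); lra.
Qed.

(** Summing over all 2^n sets is affordable: an edge-closed set of linear size
    has probability exp (- (n lam)) up to a constant in the exponent. *)
Lemma negligible_balanced_cut : negligible (fun n H =>
  exists2 S, edge_closed H S & (n <= 4 * #|S|)%N && (2 * #|S| <= n)%N).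
Proof.
move=> eps eps0; near=> n.
have h4 : (4 * d <= n)%N by near: n; exact: nbhs_infty_ge.
have h8 : 8 * 4 ^+ d <= lam n by near: n; exact: near_lam_infty.
have he : expR (- n%:R) <= eps by near: n; exact: near_expR_nat.
(* Any delta that is much smaller than 2^-n would do. *)
apply: le_trans (prob_closed_set (delta := expR (- (2 * n%:R))) hd (hp n) _ _) _.
- exact: expR_ge0.
- move=> S /andP[nS Sn]; apply: le_trans (pow_le_expR _ (hp n)) _.
  rewrite ler_expR lerN2 natrM mulrCA.
  have h1 := lam_quarter Sn h4.
  have h2 : 8 <= lam n / 4 ^+ d by rewrite ler_pdivlMr ?exprn_gt0.
  apply: le_trans (_ : #|S|%:R * 8 <= _); last by rewrite ler_wpM2l // (le_trans h2).
  by rewrite -!natrM ler_nat; lia.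
apply: le_trans he; apply: le_trans (ler_wpM2r (expR_ge0 _) (exp2_le n)) _.
rewrite -expRD ler_expR; lra.
Unshelve. all: by end_near. Qed.

(** In prob_component the factor 2^s is absorbed by exp (- (c s lam)), and the
    remaining factor n by taking s at least a constant K with c K lam >= 2 L. *)
Lemma negligible_medium_component : negligible (fun n H =>
  exists2 S, S \in components H &
    (8 * 4 ^ d * B <= #|S|)%N && (2 * #|S| <= n)%N).
Proof.
move=> eps eps0; near=> n.
have h4 : (4 * d <= n)%N by near: n; exact: nbhs_infty_ge.
have h8 : 4 * 4 ^+ d <= lam n by near: n; exact: near_lam_infty.
have he : expR (- L n) <= eps by near: n; exact: near_expR_le.
have hL : L n <= B%:R * lam n by near: n; exact: near_lam_ge_ln.
have hn : expR (L n) = n%:R by near: n; exact: near_expR_ln.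
have L0 : 0 <= L n by near: n; exact: near_ln.
apply: le_trans (prob_component (delta := expR (- (2 * L n))) hd (hp n) _ _) _.
- exact: expR_ge0.
- move=> S /andP[KS Sn]; have /andP[p0 p1] := hp n.
  have p2 : 0 <= p n / 2 <= 1 by lra.
  apply: le_trans (ler_pM _ _ (exp2_le _) (pow_le_expR _ p2)) _ => //.
    by rewrite exprn_ge0 //; lra.
  rewrite -expRD ler_expR natrM mulrCA.
  have h1 := lam_quarter Sn h4.
  set y : R := lam n / 4 ^+ d in h1.
  have y4 : 4 <= y by rewrite ler_pdivlMr ?exprn_gt0.
  have h2 : #|S|%:R * (y / 2) <= #|S|%:R * (p n / 2 * 'C(n - #|S|, d)%:R) :> R.
    by rewrite ler_wpM2l //; lra.
  have h3 : (8 * 4 ^+ d * B%:R) * (y / 4) <= #|S|%:R * (y / 4).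
    apply: ler_wpM2r; first lra.
    by rewrite -natrX -!natrM ler_nat.
  have h5 : (8 * 4 ^+ d * B%:R) * (y / 4) = 2 * (B%:R * lam n).
    by rewrite /y; field; rewrite expf_neq0.
  have h6 : 0 <= #|S|%:R * (y / 4 - 1) by rewrite mulr_ge0 //; lra.
  lra.
rewrite -hn -expRD; apply: le_trans he; rewrite ler_expR; lra.
Unshelve. all: by end_near. Qed.

Lemma near_lnln_lam t A : \forall n \near \oo, t%:R * M n - lam n <= - A.
Proof.
near=> n.
have hL : L n <= B%:R * lam n by near: n; exact: near_lam_ge_ln.
have h1 : 2 * (B%:R * t%:R) * M n <= L n by near: n; exact: near_lnln_lin.
have h2 : 2 * (B%:R * A) <= L n by near: n; exact: near_ln.
rewrite -(ler_pM2l (_ : 0 < B%:R)) ?ltr0n //; lra.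
Unshelve. all: by end_near. Qed.

(** The pairs (number of vertices, number of edges) of a component other than
    those of butterflies with at most l edges; no component has s > 1 + d t. *)
Definition excluded s t := (0 < s)%N /\
  [\/ (s <= d * t)%N, (s <= 1 + d * t)%N /\ (B < s)%N | s = B /\ t = l.+1].

(** The exponent of n^s p^t exp (- s lam).  In the third case it is - c_(l+1) by
    definition; in the other two it is at most t M - lam, because
    (s - d t) L <= (s - 1) lam. *)
Lemma excluded_exponent s t A : excluded s t -> \forall n \near \oo,
  s%:R * L n - t%:R * (d%:R * L n) + t%:R * M n - s%:R * lam n <= - A.
Proof.
move=> [s0 hst]; near=> n.
have hL : L n <= B%:R * lam n by near: n; exact: near_lam_ge_ln.
have key : t%:R * M n - lam n <= - A by near: n; exact: near_lnln_lam.
have L0 : 0 <= L n by near: n; exact: near_ln.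
have lam0 := lam_ge0 n.
have top : L n + l.+1%:R * M n + A <= B%:R * lam n by near: n; exact: near_lam_ge.
have s1 : lam n <= s%:R * lam n by rewrite ler_peMl // ler1n.
case: hst => [sdt|[sdt sB]|[sE tE]].
- have : s%:R * L n <= (d * t)%:R * L n by rewrite ler_wpM2r // ler_nat.
  by rewrite natrM; lra.
- have : s%:R * L n <= (1 + d * t)%:R * L n by rewrite ler_wpM2r // ler_nat.
  have : B.+1%:R * lam n <= s%:R * lam n by rewrite ler_wpM2r // ler_nat.
  by rewrite -[B.+1%:R]natr1 natrD natrM; lra.
have -> : s%:R * L n = L n + t%:R * (d%:R * L n).
  by rewrite sE tE natrD natrM; ring.
by rewrite sE tE; lra.
Unshelve. all: by end_near. Qed.

Lemma pE n : (0 < n)%N -> p n = lam n * d`!%:R / n%:R ^+ d.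
Proof.
move=> n0; rewrite /lam divfK ?pnatr_eq0 -?lt0n ?fact_gt0 // mulrC mulKf //.
by rewrite expf_neq0 // pnatr_eq0 -lt0n.
Qed.

Lemma negligible_excluded s t : excluded s t -> negligible (fun n H =>
  exists S, [/\ edge_closed H S, #|S| = s & #|edges_in H S| = t]).
Proof.
move=> exc eps eps0.
have [A hA] := expR_small (2 ^+ (2 ^ s) * (2 * d`!%:R) ^+ t * expR s%:R) eps0.
near=> n.
have n0 : (0 < n)%N by near: n; exact: nbhs_infty_gt.
have hn : expR (L n) = n%:R by near: n; exact: near_expR_ln.
have hM : expR (M n) = L n by near: n; exact: near_expR_lnln.
have hlam : lam n <= 2 * L n by near: n; exact: near_lam_le.
have hC : lam n - 1 <= p n * 'C(n - s, d)%:R by near: n; exact: near_lam_fixed.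
have hG : s%:R * L n - t%:R * (d%:R * L n) + t%:R * M n - s%:R * lam n <= - A.
  by near: n; exact: excluded_exponent.
have ub := @prob_small_closed R d n (p n) s t hd (hp n).
apply: le_trans ub _.
apply: le_trans (hA _ hG).
have e1 : n%:R ^+ s = expR (s%:R * L n) by rewrite expRM_natl hn.
have e2 : p n ^+ t <= (2 * d`!%:R) ^+ t * expR (t%:R * M n - t%:R * (d%:R * L n)).
  rewrite -mulrBr expRM_natl -exprMn; apply: lerXn2r.
  - by rewrite nnegrE; have /andP[] := hp n.
  - by rewrite nnegrE !mulr_ge0 ?expR_ge0.
  rewrite pE // expRD expRN expRM_natl hn hM mulrA ler_wpM2r ?invr_ge0 ?exprn_ge0 //.
  by rewrite [leRHS]mulrAC ler_wpM2r.
have e3 : (1 - p n) ^+ (s * 'C(n - s, d)) <= expR s%:R * expR (- (s%:R * lam n)).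
  apply: le_trans (pow_le_expR _ (hp n)) _; rewrite -expRD ler_expR natrM mulrCA.
  have : s%:R * (lam n - 1) <= s%:R * (p n * 'C(n - s, d)%:R) by rewrite ler_wpM2l.
  lra.
have -> : s%:R * L n - t%:R * (d%:R * L n) + t%:R * M n - s%:R * lam n =
   s%:R * L n + (t%:R * M n - t%:R * (d%:R * L n)) + - (s%:R * lam n) by ring.
have /andP[p0 p1] := hp n.
have e4 := ler_pM (exprn_ge0 t p0) (exprn_ge0 _ (_ : 0 <= 1 - p n)) e2 e3.
move: e4; rewrite (expRD _ (- (s%:R * lam n))) (expRD (s%:R * L n)) -e1.
set Y := expR (_ - _); set Z := expR (- _); set W := expR s%:R => e4.
apply: le_trans (ler_wpM2l _ (e4 _)) _; rewrite ?mulr_ge0 ?expR_ge0 ?exprn_ge0 ?subr_ge0 //.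
by rewrite le_eqVlt; apply/orP; left; apply/eqP; ring.
Unshelve. all: by end_near. Qed.

Lemma bin_ge_half n m : (2 * m <= n)%N ->
  (n%:R / 2) ^+ m / m`!%:R <= 'C(n, m)%:R :> R.
Proof.
move=> mn; have f0 : 0 < m`!%:R :> R by rewrite ltr0n fact_gt0.
rewrite ler_pdivrMr // -natrM bin_ffact expr_div_n ler_pdivrMr ?exprn_gt0 //.
rewrite -!natrX -natrM ler_nat mulnC.
apply: leq_trans (leq_mul (leqnn _) (expr_le_ffact _ _)).
by rewrite -expnMn; case: m mn {f0} => [//|m] mn; rewrite leq_exp2r //; lia.
Qed.

(** The mean number of copies is at least a constant times exp (- c_j). *)
Lemma near_copies (m j : nat) : m = (1 + d * j)%N -> (j <= l)%N -> forall A : R,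
  \forall n \near \oo,
   A <= 'C(n, m)%:R * (p n ^+ j * (1 - p n) ^+ (m * 'C(n, d))).
Proof.
move=> mE jl A.
pose K : R := (2^-1) ^+ m / m`!%:R * (d`!%:R / B%:R) ^+ j * expR (- 2 * m%:R).
have K0 : 0 < K.
  rewrite !mulr_gt0 ?expR_gt0 ?exprn_gt0 ?divr_gt0 ?invr_gt0 ?ltr0n ?fact_gt0 //.
near=> n.
have n0 : (0 < n)%N by near: n; exact: nbhs_infty_gt.
have nR0 : 0 < n%:R :> R by rewrite ltr0n.
have mn : (2 * m <= n)%N by near: n; exact: nbhs_infty_ge.
have hn : expR (L n) = n%:R by near: n; exact: near_expR_ln.
have hM : expR (M n) = L n by near: n; exact: near_expR_lnln.
have L0 : 0 <= L n by near: n; exact: near_ln.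
have hlam : lam n <= 2 * L n by near: n; exact: near_lam_le.
have hlam' : L n <= B%:R * lam n by near: n; exact: near_lam_ge_ln.
have hp2 : p n <= 2^-1 by near: n; apply: near_p_small; rewrite invr_gt0.
have hsq : 4 * d`!%:R * L n ^+ 2 <= n%:R by near: n; exact: near_ln_sqr.
have hc : c_ d j p n <= - (A / K) by near: n; move/cvgrNyPle : (c_cvgNy jl); apply.
have lam0 := lam_ge0 n; have /andP[p0 p1] := hp n.
have f0 : 0 < d`!%:R :> R by rewrite ltr0n fact_gt0.
have pC : p n * 'C(n, d)%:R <= lam n.
  rewrite /lam ler_pdivlMr // -mulrA -natrM bin_ffact [_ ^+ d * _]mulrC ler_wpM2l //.
  rewrite -natrX ler_nat; elim: (d) => [//|r IH].
  by rewrite ffactnSr expnSr leq_mul // leq_subr.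
have plam : p n * lam n <= 1.
  have h1 : n%:R * p n <= lam n * d`!%:R.
    rewrite /lam divfK ?gt_eqF // ler_wpM2r //.
    by rewrite -(prednK hd) exprS ler_peMr // exprn_ege1 // ler1n.
  rewrite -(ler_pM2l nR0) mulr1 mulrA.
  have h2 : n%:R * p n * lam n <= lam n * d`!%:R * lam n by rewrite ler_wpM2r.
  have h3 : lam n * lam n <= (2 * L n) * (2 * L n) by apply: ler_pM.
  have h4 : d`!%:R * (lam n * lam n) <= d`!%:R * (2 * L n * (2 * L n)).
    by rewrite ler_wpM2l // ltW.
  lra.
have q1 : expR (- 2 * m%:R) * expR (- (m%:R * lam n)) <= (1 - p n) ^+ (m * 'C(n, d)).
  have hp2' : 0 <= p n <= 2^-1 by rewrite p0.
  apply: le_trans (pow_ge_expR _ hp2'); rewrite -expRD ler_expR natrM.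
  have h1 : m%:R * (p n * 'C(n, d)%:R) <= m%:R * lam n by rewrite ler_wpM2l.
  have h2 : m%:R * (p n * (p n * 'C(n, d)%:R)) <= m%:R * 1.
    by rewrite ler_wpM2l //; apply: le_trans plam; rewrite ler_wpM2l.
  lra.
have q2 : (d`!%:R / B%:R) ^+ j * expR (j%:R * M n - j%:R * (d%:R * L n)) <= p n ^+ j.
  rewrite -mulrBr expRM_natl -exprMn; apply: lerXn2r.
  - by rewrite nnegrE mulr_ge0 ?expR_ge0 ?divr_ge0 ?ltW.
  - by rewrite nnegrE.
  rewrite pE // expRD expRN expRM_natl hn hM mulrA ler_wpM2r ?invr_ge0 ?exprn_ge0 //.
  rewrite mulrAC [leRHS]mulrC; rewrite -[leLHS]mulrA; apply: ler_wpM2l (ltW f0) _ _ _.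
  by rewrite ler_pdivrMr ?ltr0n // [leRHS]mulrC.
have q3 : (2^-1) ^+ m / m`!%:R * expR (m%:R * L n) <= 'C(n, m)%:R.
  apply: le_trans (bin_ge_half mn); rewrite expRM_natl hn.
  by rewrite exprMn mulrAC [n%:R ^+ m * _]mulrC.
have d0 : 0 <= d`!%:R / B%:R :> R by rewrite divr_ge0.
apply: le_trans (ler_pM _ _ q3 (ler_pM _ _ q2 q1));
  rewrite ?mulr_ge0 ?expR_ge0 ?exprn_ge0 ?invr_ge0 //.
have -> : (2^-1) ^+ m / m`!%:R * expR (m%:R * L n) *
    ((d`!%:R / B%:R) ^+ j * expR (j%:R * M n - j%:R * (d%:R * L n)) *
     (expR (- 2 * m%:R) * expR (- (m%:R * lam n)))) =
   K * (expR (m%:R * L n) * expR (j%:R * M n - j%:R * (d%:R * L n)) *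
        expR (- (m%:R * lam n))) by rewrite /K; ring.
rewrite -!expRD mulrC -ler_pdivrMr //.
have -> : m%:R * L n + (j%:R * M n - j%:R * (d%:R * L n)) + - (m%:R * lam n) = - c_ d j p n.
  by rewrite c_E mE !natrD !natrM; ring.
apply: le_trans (expR_ge1Dx _); lra.
Unshelve. all: by end_near. Qed.

Lemma negligible_few_copies (k m : nat) (Bf : hypergraph 'I_m) :
  butterfly d Bf -> (#|Bf| <= l)%N -> negligible (fun n H =>
  (#|[set C in components H | `[< isomorphic Bf (sub_hypergraph H C) >]]| < k)%N).
Proof.
move=> bB Bl eps eps0.
have mE : m = (1 + d * #|Bf|)%N.
  by have [con acy uB] := bB; rewrite -(acyclic_card hd con acy uB) card_ord.
pose eta : R := eps / 8; have eta0 : 0 < eta by rewrite divr_gt0.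
near=> n.
have n0 : (0 < n)%N by near: n; exact: nbhs_infty_gt.
have nR0 : 0 < n%:R :> R by rewrite ltr0n.
have nu8 : 8 / eps <= 'C(n, m)%:R * (p n ^+ #|Bf| * (1 - p n) ^+ (m * 'C(n, d))).
  by near: n; apply: (near_copies mE Bl).
have nuk : 2 * k%:R <= 'C(n, m)%:R * (p n ^+ #|Bf| * (1 - p n) ^+ (m * 'C(n, d))).
  by near: n; apply: (near_copies mE Bl).
set nu := 'C(n, m)%:R * _ in nu8 nuk.
have nu0 : 0 < nu by apply: lt_le_trans nu8; rewrite divr_gt0.
have hlam : lam n <= 2 * L n by near: n; exact: near_lam_le.
have hL : (1 + eta) / eta * (m * m)%:R * d`!%:R * 2 * L n <= n%:R.
  by near: n; exact: near_ln_lin.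
apply: le_trans (prob_few_copies hd (hp n) (ltW eta0) bB _ nu0 nuk) _; last first.
  rewrite -/nu; have : 4 / nu <= eps / 2.
    rewrite ler_pdivrMr // -ler_pdivrMl ?divr_gt0 //; apply: le_trans nu8.
    by rewrite le_eqVlt; apply/orP; left; apply/eqP; field; rewrite gt_eqF.
  rewrite /eta; lra.
have /andP[p0 p1] := hp n.
apply: le_trans (_ : (1 + eta) * (1 - (m * m * n ^ d.-1)%:R * p n) <= _); last first.
  by rewrite ler_wpM2l ?bernoulli //; lra.
have key : (1 + eta) * ((m * m * n ^ d.-1)%:R * p n) <= eta.
  have f0 : 0 < d`!%:R :> R by rewrite ltr0n fact_gt0.
  have h1 : n%:R ^+ d.-1 * p n * n%:R = lam n * d`!%:R.
    rewrite /lam divfK ?gt_eqF // mulrAC -exprSr prednK //.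
  rewrite natrM natrX -(ler_pM2r nR0).
  have -> : (1 + eta) * ((m * m)%:R * n%:R ^+ d.-1 * p n) * n%:R =
     (1 + eta) * (m * m)%:R * d`!%:R * lam n.
    by rewrite -[_ * d`!%:R * _]mulrA [d`!%:R * _]mulrC -h1; ring.
  apply: le_trans (_ : (1 + eta) * (m * m)%:R * d`!%:R * (2 * L n) <= _).
    by rewrite ler_wpM2l // !mulr_ge0 //; lra.
  have -> : (1 + eta) * (m * m)%:R * d`!%:R * (2 * L n) =
     eta * ((1 + eta) / eta * (m * m)%:R * d`!%:R * 2 * L n).
    by field; rewrite gt_eqF.
  by rewrite ler_wpM2l // ltW.
lra.
Unshelve. all: by end_near. Qed.

(** * The two halves of the theorem *)
Lemma aas_small_outside_largest : aas d p (small_outside_largest d l).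
Proof.
pose K := (8 * 4 ^ d * B)%N.
pose Bad3 (u : 'I_K * 'I_(2 ^ K).+1) n (H : hypergraph 'I_n) :=
  excluded u.1 u.2 /\
  exists S, [/\ edge_closed H S, #|S| = u.1 & #|edges_in H S| = u.2].
have neg3 u : negligible (Bad3 u).
  have [exc|nexc] := pselect (excluded u.1 u.2).
    move=> eps eps0; apply: filterS (negligible_excluded exc eps0) => n; apply: le_trans.
    by apply: Pr_mono => H _ [].
  move=> eps eps0; apply: nearW => n; apply: le_trans (_ : 0 <= _); last exact: ltW.
  by rewrite PrE /product_prob big_pred0 // => H; apply/asboolP => -[].
apply: negligible_aas (negligible_or negligible_balanced_cut
  (negligible_or negligible_medium_component (negligible_exists neg3))).
move=> n H HE nbad; have uH := potential_uniform HE.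
have [] := @giant_component _ H n; first exact: card_ord.
  by move=> T cl T4 T2; apply: nbad; left; exists T => //; rewrite T4 T2.
move=> G Gc G2.
have small C : C \in components H -> C != G -> (#|C| + #|G| <= n)%N.
  by move=> Cc CG; rewrite -[leqRHS](card_ord n) (card_component_pair Cc Gc).
exists G.
  by split=> // C Cc CG; have := small C Cc CG; lia.
move=> C Cc CG; have CG2 := small C Cc CG.
have CK : (#|C| < K)%N.
  rewrite ltnNge; apply/negP => KC; apply: nbad; right; left; exists C => //.
  by rewrite KC; lia.
set t := #|edges_in H C|.
have tK : (t < (2 ^ K).+1)%N.
  rewrite ltnS; apply: (@leq_trans #|powerset C|).
    by apply: subset_leq_card; apply/fintype.subsetP => e; rewrite !inE => /andP[].
  by rewrite card_powerset leq_exp2l // ltnW.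
have nexc : ~ excluded #|C| t.
  move=> exc; apply: nbad; right; right; exists (Ordinal CK, Ordinal tK); split=> //.
  by exists C; split=> //; apply: component_edge_closed.
have C0 := component_gt0 Cc.
have Cle := component_card Cc uH; rewrite -/t in Cle.
have Ct : #|C| = (1 + d * t)%N.
  apply/eqP; rewrite eqn_leq Cle /=; rewrite leqNgt; apply/negP => lt.
  by apply: nexc; split=> //; apply: Or31.
have tl : (t <= l)%N.
  rewrite leqNgt; apply/negP => lt; apply: nexc; split=> //.
  have [tE|tl] := eqVneq t l.+1.
    by apply: Or33; split=> //; rewrite Ct tE mulnC.
  apply: Or32; split; first by rewrite Ct.
  by rewrite Ct ltn_add2l [(l.+1 * d)%N]mulnC ltn_mul2l hd ltn_neqAle eq_sym tl.
split; last by rewrite card_sub_hypergraph.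
exact: component_butterfly.
Qed.

Lemma aas_all_small_butterflies k : aas d p (all_small_butterflies d l k).
Proof.
pose N := (1 + d * l).+1.
pose Few (u : {m : 'I_N & {set {set 'I_m}}}) n (H : hypergraph 'I_n) :=
  [/\ butterfly d (tagged u), (#|tagged u| <= l)%N &
   (#|[set C in components H | `[< isomorphic (tagged u) (sub_hypergraph H C) >]]| < k)%N].
have neg u : negligible (Few u).
  have [[bB Bl]|nB] := pselect (butterfly d (tagged u) /\ (#|tagged u| <= l)%N).
    move=> eps eps0; apply: filterS (negligible_few_copies k bB Bl eps0) => n.
    by apply: le_trans; apply: Pr_mono => H _ [].
  move=> eps eps0; apply: nearW => n; apply: le_trans (_ : 0 <= _); last exact: ltW.
  by rewrite PrE /product_prob big_pred0 // => H; apply/asboolP => -[h1 h2 _]; apply: nB.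
apply: negligible_aas (negligible_exists neg) => n H HE nbad m Bf bB Bl.
rewrite leqNgt; apply/negP => few; apply: nbad.
have mN : (m < N)%N.
  have [con acy uB] := bB; rewrite ltnS -[leqLHS](card_ord m).
  by rewrite (acyclic_card hd con acy uB) leq_add2l leq_mul2l Bl orbT.
by exists (existT (fun m : 'I_N => {set {set 'I_m}}) (Ordinal mN) Bf).
Qed.

End Asymptotics.

Theorem theorem6p6 (R : realType) (d l : nat) (p : nat -> R) (k : nat)
    (hd : (1 <= d)%N)
    (hp : forall n : nat, 0 <= p n <= 1)
    (hl : (c_ d l p n @[n --> \oo] --> -oo%R)%classic)
    (hl1 : (c_ d l.+1 p n @[n --> \oo] --> +oo%R)%classic) :
  aas d p (small_outside_largest d l) /\
  aas d p (all_small_butterflies d l k).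
Proof.
split; first exact: aas_small_outside_largest.
exact: aas_all_small_butterflies.
Qed.
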